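(* Under the standing assumptions of the context, let $0\le i\le T-1$. Assume $C_G(P_i)\le P_i$ and that every automorphism of $G$ induced by a derivation in $\mathrm{Der}(G/P_i,\Omega_1(Z(P_i)))$ is inner. If $C_G(P_{i+1})\not\le P_{i+1}$, then $G$ has a non-inner automorphism of order $p$.
   Context: Standing assumptions: $p$ is an odd prime; $G$ is a finite non-abelian $p$-group with cyclic center; $\Omega_1(Z(G))\le\gamma_3(G)G^p$ and $|\Phi(G)/\gamma_3(G)G^p|=p^T\ge p$. Fix normal subgroups $\gamma_3(G)G^p=P_T\le P_{T-1}\le\cdots\le P_1\le P_0=\Phi(G)$ with $|P_i/P_{i+1}|=p$. Here $\Omega_1(X)=\langle x:x^p=1\rangle$, $G^p=\langle g^p\rangle$. $\mathrm{Der}(G/P_i,\Omega_1(Z(P_i)))$ is the set of maps $\delta:G\to\Omega_1(Z(P_i))$ with $\delta(xy)=\delta(x)^y\delta(y)$ (conjugation action) and $\delta(P_i)=1$; the automorphism induced by $\delta$ is $g\mapsto g\delta(g)$. *)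

(* Defs.v *)
From mathcomp Require Import all_boot all_fingroup all_solvable.
Set Implicit Arguments. Unset Strict Implicit. Unset Printing Implicit Defensive.
Local Open Scope group_scope.

(* d is a derivation in Der(G/K, N): a map G -> N with
   d(xy) = d(x)^y d(y) for x, y in G, and d(K) = 1. *)
Definition is_derivation (gT : finGroupType) (G K N : {set gT}) (d : gT -> gT) : Prop :=
  [/\ {in G &, forall x y, d (x * y) = d x ^ y * d y},
      {in G, forall x, d x \in N} &
      {in K, forall x, d x = 1}].

Definition induced_aut_inner (gT : finGroupType) (G : {set gT}) (d : gT -> gT) : Prop :=
  exists2 h, h \in G & {in G, forall g, g * d g = g ^ h}.

Definition inner_aut (gT : finGroupType) (G : {set gT}) (a : {perm gT}) : Prop :=
  exists2 h, h \in G & {in G, forall g, a g = g ^ h}.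

(* Main.v *)
(* Put W = P_T = gamma_3(G)G^p and suppose that every automorphism of order p is
   inner.  It suffices to show C_G(W) <= W, since W <= P_(i+1).

   Let E = Omega_1(C_G(Phi(G))).  Fixing a linear form chi on E that is nonzero on
   Omega_1(Z(G)), the map a |-> (g |-> chi(a^g)) embeds E, G-equivariantly, into
   the F_p-valued functions on G; a function psi all of whose differences
   psi(yg) - psi(g) come from an elementary abelian normal subgroup yields a
   derivation, hence an element h of G inducing it.  The hypothesis on P_i
   provides the functions of degree 1 (homomorphisms G -> F_p), then derivations
   into these provide the quadratic ones, and also, for every linear form phi on
   Phi(G)/W, an element t of C_G(W) with [t,y] of degree 1 for all y and
   [t,u] = z^phi(u) on Phi(G), by way of a quadratic function eps on G extending
   phi.  The elements so obtained may have order > p, but only by one dimension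
   as Z(G) is cyclic: the obstruction is the linear form m |-> m^p modulo Z(G)^p,
   and it is evaded by prescribing the polar form of eps.

   If C_G(W) were not in W, there would be such a t of order p outside W.  For a
   nonzero homomorphism mu, the function g |-> mu(g) chi(t^g), corrected by a
   quadratic one, defines a derivation d with d(y) = t^mu(y) modulo C_G(Phi(G)),
   and the automorphism g |-> g d(g) of order p cannot be inner. *)

Require Import Defs.
From mathcomp Require Import all_boot all_algebra all_fingroup.
From mathcomp Require Import all_solvable all_character.
From mathcomp Require Import ring.
Set Implicit Arguments.
Unset Strict Implicit.
Unset Printing Implicit Defensive.
Import GRing.Theory.
Local Open Scope group_scope.

(** * Homomorphisms to the prime field *)

Section Additive.
Variable p : nat.
Hypothesis pr_p : prime p.

Lemma Fp_natr_p : p%:R%R = 0%R :> 'F_p.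
Proof. exact: pchar_Fp_0. Qed.

Lemma Fp_nat_val (a : 'F_p) : (a : nat)%:R%R = a.
Proof.
apply: val_inj; rewrite /= val_Fp_nat // modn_small //.
by rewrite -[X in _ < X](card_Fp pr_p) card_ord.
Qed.

Variable gT : finGroupType.
Implicit Types (A B X Y G : {group gT}) (f chi : gT -> 'F_p).

Definition additive_on (A : {set gT}) f :=
  {in A &, forall x y, f (x * y) = (f x + f y)%R}.

Lemma additive_on1 A f : additive_on A f -> f 1 = 0%R.
Proof.
move=> fD; have := fD 1 1 (group1 A) (group1 A).
by rewrite mulg1 => /eqP; rewrite -subr_eq0 opprD addNKr oppr_eq0 => /eqP.
Qed.

Lemma additive_onV A f x : additive_on A f -> x \in A -> f x^-1 = (- f x)%R.
Proof.
move=> fD Ax; apply/eqP; rewrite -addr_eq0 -fD ?groupV //.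
by rewrite mulVg (additive_on1 fD).
Qed.

Lemma additive_onX A f x n : additive_on A f -> x \in A ->
  f (x ^+ n) = (n%:R * f x)%R.
Proof.
move=> fD Ax; elim: n => [|n IHn]; first by rewrite expg0 (additive_on1 fD) mul0r.
by rewrite expgS fD ?groupX // IHn -natr1 mulrDl mul1r addrC.
Qed.

Lemma additive_onR A f x y : additive_on A f -> x \in A -> y \in A ->
  f [~ x, y] = 0%R.
Proof.
move=> fD Ax Ay; rewrite commgEl conjgE !fD ?groupM ?groupV //.
by rewrite !(additive_onV fD) //; ring.
Qed.

Lemma additive_on_ker_group A f : additive_on A f ->
  group_set [set x in A | f x == 0%R].
Proof.
move=> fD; apply/group_setP; split=> [|x y].
  by rewrite inE group1 (additive_on1 fD) eqxx.
rewrite !inE => /andP[Ax /eqP fx] /andP[Ay /eqP fy].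
by rewrite groupM // fD // fx fy addr0 eqxx.
Qed.

Lemma additive_on_Phi G f x : p.-group G -> additive_on G f ->
  x \in 'Phi(G) -> f x = 0%R.
Proof.
move=> pG fD; rewrite (Phi_joing pG) (MhoE _ pG) => Px.
have /subsetP/(_ x Px): G^`(1) <*> <<[set x ^+ (p ^ 1) | x in G]>>
    \subset Group (additive_on_ker_group fD).
  rewrite join_subG !gen_subG; apply/andP; split; apply/subsetP=> y.
    case/imset2P=> a b Ga Gb ->.
    by rewrite inE groupR //= (additive_onR fD) ?eqxx.
  case/imsetP=> a Ga ->.
  by rewrite inE groupX //= (additive_onX _ fD) // expn1 Fp_natr_p mul0r.
by rewrite inE => /andP[_ /eqP].
Qed.

(* The exponent of [x] as a power of [w], modulo p; junk value 0 off <[w]>. *)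
Definition dlog (w x : gT) : 'F_p :=
  if [pick i : 'I_#[w] | x == w ^+ i] is Some i then (i : nat)%:R%R else 0%R.

Lemma dlogX w n : p %| #[w] -> dlog w (w ^+ n) = n%:R%R.
Proof.
move=> pw; rewrite /dlog; case: pickP => [i | /(_ (Ordinal (ltn_pmod n (order_gt0 w))))].
  rewrite eq_expg_mod_order => /eqP eqni.
  have : n = i %[mod p] by rewrite -(modn_dvdm n pw) eqni modn_dvdm.
  by move=> e; rewrite -(Fp_nat_mod pr_p n) e Fp_nat_mod.
by rewrite expg_mod_order eqxx.
Qed.

Lemma dlog_additive w : p %| #[w] -> additive_on <[w]> (dlog w).
Proof.
move=> pw x y /cycleP[i ->] /cycleP[j ->].
by rewrite -expgD !dlogX // natrD.
Qed.

Lemma dlog0 w x : p %| #[w] -> x \in <[w]> -> dlog w x = 0%R ->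
  exists2 y, y \in <[w]> & x = y ^+ p.
Proof.
move=> pw /cycleP[i ->]; rewrite dlogX // => /eqP.
rewrite -(dvdn_pcharf (pchar_Fp pr_p)) => /dvdnP[j ->].
by exists (w ^+ j); rewrite ?mem_cycle // expgM.
Qed.

(** As [A] is elementary abelian, [B] has a complement in it; [chi] is composed with the projection
    onto [B] along that complement. *)
Lemma additive_on_extend A B chi : p.-abelem A -> B \subset A ->
  additive_on B chi ->
  exists2 f, additive_on A f & {in B, f =1 chi}.
Proof.
move=> abA sBA chiD; have [R compR] := splitsP (abelem_splits abA sBA).
have cRB : R \subset 'C(B).
  have [_ cAA] := andP abA; case/complP: compR => _ defA.
  apply: subset_trans (subset_trans (abelem_abelian abA) (centS sBA)).
  by rewrite -defA mulG_subr.
exists (chi \o divgr B R) => [x y Ax Ay | x Bx] /=; last by rewrite divgr_id.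
by case/complP: (compR) => _ defA; rewrite (divgrM compR) // chiD // mem_divgr ?defA.
Qed.

End Additive.

Lemma additive_on_separate p (gT : finGroupType) (X Y : {group gT}) x :
  prime p -> X <| Y -> p.-abelem (Y / X) -> x \in Y -> x \notin X ->
  exists f : gT -> 'F_p,
    [/\ additive_on Y f, {in X, forall y, f y = 0%R} & f x = 1%R].
Proof.
move=> pr_p nXY abYX Yx X'x; set w := coset X x.
have Nx y : y \in Y -> y \in 'N(X) by apply: subsetP (normal_norm nXY) y.
have Qw : w \in Y / X by rewrite mem_quotient.
have w1 : w != 1 by apply: contra X'x => /eqP w1; apply: coset_idr (Nx _ Yx) w1.
have ow : #[w] = p by rewrite (abelem_order_p abYX).
have dw : p %| #[w] by rewrite ow.
have swQ : <[w]> \subset Y / X by rewrite cycle_subG.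
have [f fD fE] := additive_on_extend abYX swQ (dlog_additive pr_p dw).
exists (f \o coset X); split=> [y z Yy Yz | y Xy | ] /=.
- by rewrite morphM ?Nx // fD ?mem_quotient.
- by rewrite coset_id // (additive_on1 fD).
- rewrite -/w fE ?cycle_id // -[X in dlog _ _ X]expg1 dlogX //.
Qed.

(** * Linear coordinates on the Frattini quotient *)

Section Coordinates.
Variable p : nat.
Hypothesis pr_p : prime p.

Lemma Fp_additiveZ (V : lmodType 'F_p) (f : V -> 'F_p) a r :
  {morph f : x y / (x + y)%R} -> f (a *: r)%R = (a * f r)%R.
Proof.
move=> fD; have f0 : f 0%R = 0%R.
  by have /eqP := fD 0%R 0%R; rewrite addr0 -subr_eq0 opprD addNKr oppr_eq0 => /eqP.
rewrite -(Fp_nat_val pr_p a) scaler_nat mulr_natl.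
by elim: (a : nat) => [|n IHn]; rewrite ?mulr0n // !mulrS fD IHn.
Qed.

Lemma additive_rV n (f : 'rV['F_p]_n -> 'F_p) : {morph f : x y / (x + y)%R} ->
  exists u : 'cV_n, forall r, f r = ((r *m u)%R 0%R 0%R).
Proof.
move=> fD; exists (\col_i f (delta_mx 0 i))%R => r.
have f0 : f 0%R = 0%R by rewrite -(scale0r (0 : 'rV_n)%R) Fp_additiveZ // mul0r.
rewrite {1}[r]row_sum_delta (big_morph f fD f0) mxE.
by apply: eq_bigr => j _; rewrite Fp_additiveZ // !mxE.
Qed.

Lemma additive_cV n (f : 'cV['F_p]_n -> 'F_p) : {morph f : x y / (x + y)%R} ->
  exists r : 'rV_n, forall u, f u = ((r *m u)%R 0%R 0%R).
Proof.
move=> fD; have [|u fE] := @additive_rV n (f \o trmx).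
  by move=> x y /=; rewrite linearD fD.
exists u^T%R => v; have := fE v^T%R; rewrite /= trmxK => ->.
by rewrite -[in RHS](trmxK v) -trmx_mul !mxE.
Qed.

Lemma Frattini_coordinates (gT : finGroupType) (G : {group gT}) :
    p.-group G -> ~~ cyclic G ->
  exists n (rho : gT -> 'rV['F_p]_n), [/\ 1 < n,
    {in G &, forall x y, rho (x * y) = (rho x + rho y)%R},
    forall r, exists2 g, g \in G & rho g = r
    & {in G, forall g, rho g = 0%R -> g \in 'Phi(G)}].
Proof.
move=> pG ncG; have abQ := Phi_quotient_abelem pG.
have Ng g : g \in G -> g \in 'N('Phi(G)) by apply: subsetP (normal_norm (Phi_normal G)) g.
have ntQ : G / 'Phi(G) != 1.
  by apply: contra ncG => /eqP Q1; apply: Phi_quotient_cyclic; rewrite Q1 cyclic1.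
exists _, (fun g => abelem_rV abQ ntQ (coset 'Phi(G) g)); split.
- rewrite ltnNge; apply: contra ncG => dim1; apply: Phi_quotient_cyclic.
  by rewrite (abelem_cyclic abQ) -(dim_abelemE abQ ntQ).
- by move=> x y Gx Gy; rewrite morphM ?Ng // abelem_rV_M ?mem_quotient.
- move=> r; have := mem_im_abelem_rV abQ ntQ r.
  by case/morphimP=> w _ /morphimP[g Ng' Gg ->] ->; exists g.
move=> g Gg; rewrite -(abelem_rV_1 abQ ntQ) => /abelem_rV_inj gP.
by apply: coset_idr (Ng g Gg) _; apply: gP; rewrite ?group1 ?mem_quotient.
Qed.
End Coordinates.

(** * Derivations as differences of functions *)

Section Core.
Variables (gT : finGroupType) (p : nat) (G W : {group gT}) (z z0 : gT).
Variables (n : nat) (rho : gT -> 'rV['F_p]_n).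
Hypotheses (pr_p : prime p) (odd_p : odd p) (pG : p.-group G).
Hypotheses (oz : #[z] = p) (Wz : z \in W) (Zz : z \in 'Z(G)).
Hypothesis defZ : 'Z(G) = <[z0]>.
Hypothesis Z1z : {in 'Z(G), forall x, x ^+ p = 1 -> x \in <[z]>}.
Hypotheses (nWG : W <| G) (sWPhi : W \subset 'Phi(G)).
Hypothesis sPhiGW : [~: 'Phi(G), G] \subset W.
Hypothesis expW : {in G, forall g, g ^+ p \in W}.
Let C := 'C_G('Phi(G)).
Hypothesis sCPhi : C \subset 'Phi(G).
Let zz (a : 'F_p) := z ^+ a.
(** This is what the assumption on derivations modulo [P_i] provides. The hypothesis after it says
    that automorphisms of order p are inner; there [d (d x) = 1] is what bounds the order. *)
Hypothesis hom_inner : forall f, additive_on G f ->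
  exists2 k, k \in C & {in G, forall g, [~ k, g] = zz (f g)}.
Hypothesis derivation_inner : forall d : gT -> gT,
    {in G &, forall x y, d (x * y) = d x ^ y * d y} ->
    {in G, forall x, [/\ d x \in G, d x ^+ p = 1 & d (d x) = 1]} ->
  exists2 h, h \in G & {in G, forall g, d g = [~ g, h]}.
Hypothesis n_gt1 : 1 < n.
Hypothesis rhoM : {in G &, forall x y, rho (x * y) = (rho x + rho y)%R}.
Hypothesis rho_onto : forall r, exists2 g, g \in G & rho g = r.
Hypothesis rho_inj : {in G, forall g, rho g = 0%R -> g \in 'Phi(G)}.

Let sWG : W \subset G. Proof. exact: normal_sub. Qed.
Let sPhiG : 'Phi(G) \subset G. Proof. exact: Phi_sub. Qed.
Let sCG : C \subset G. Proof. exact: subsetIl. Qed.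

Lemma zzD a b : zz (a + b)%R = zz a * zz b.
Proof.
rewrite /zz -expgD; apply/eqP; rewrite eq_expg_mod_order oz; apply/eqP.
by rewrite -(val_Fp_nat pr_p) -(val_Fp_nat pr_p (a + b)) Fp_nat_val // natrD !Fp_nat_val.
Qed.

Lemma zz_nat m : zz m%:R%R = z ^+ m.
Proof.
by apply/eqP; rewrite /zz eq_expg_mod_order oz val_Fp_nat // modn_mod.
Qed.

Lemma zz_inj : injective zz.
Proof.
move=> a b /eqP; rewrite /zz eq_expg_mod_order oz => /eqP.
by rewrite -!(val_Fp_nat pr_p) !Fp_nat_val // => /val_inj.
Qed.

Lemma zz0 : zz 0%R = 1. Proof. by rewrite (zz_nat 0). Qed.

Lemma zz_center a : zz a \in 'Z(G). Proof. exact: groupX. Qed.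

Lemma zzJ a g : g \in G -> zz a ^ g = zz a.
Proof.
move=> Gg; apply/conjg_fixP/commgP.
by have /centerP[_] := zz_center a; apply.
Qed.

(* The form [chi] used to view the elements of [A] as functions on [G]. *)
Definition coordinate (A : {group gT}) (chi : gT -> 'F_p) :=
  [/\ A <| G, p.-abelem A, z \in A, additive_on A chi & forall a, chi (zz a) = a].

(** The elements of [A] with all coordinates zero form a normal subgroup of [G]. If nontrivial, it
    would contain a nontrivial central power of [z], where [chi] does not vanish. *)
Lemma coordinate_inj A chi a b : coordinate A chi -> a \in A -> b \in A ->
  {in G, forall g, chi (a ^ g) = chi (b ^ g)} -> a = b.
Proof.
case=> /andP[sAG nAG] abA Az chiD chiz Aa Ab eqab.
have nA x g : x \in A -> g \in G -> x ^ g \in A.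
  by move=> Ax Gg; rewrite memJ_norm // (subsetP nAG).
have gK : group_set [set x in A | [forall g in G, chi (x ^ g) == 0%R]].
  apply/group_setP; split=> [|x y].
    rewrite inE group1; apply/forall_inP=> g Gg.
    by rewrite conj1g (additive_on1 chiD).
  rewrite !inE => /andP[Ax /forall_inP x0] /andP[Ay /forall_inP y0].
  rewrite groupM //; apply/forall_inP=> g Gg.
  by rewrite conjMg chiD ?nA // (eqP (x0 g Gg)) (eqP (y0 g Gg)) addr0.
pose K := Group gK.
have nKG : K <| G.
  apply/andP; split.
    by apply/subsetP=> x; rewrite inE => /andP[Ax _]; apply: (subsetP sAG).
  apply/subsetP=> g Gg; rewrite inE; apply/subsetP=> _ /imsetP[x Kx ->].
  move: Kx; rewrite !inE => /andP[Ax /forall_inP x0]; rewrite nA //.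
  by apply/forall_inP=> y Gy; rewrite -conjgM x0 ?groupM.
have K1 : K :=: 1.
  apply/eqP; apply: contraT => ntK.
  have := meet_center_nil (pgroup_nil pG) nKG ntK.
  case/trivgPn=> x /setIP[]; rewrite inE => /andP[Ax /forall_inP x0] Zx ntx.
  have [_ xp] := abelemP pr_p abA.
  have /cycleP[i def_x] := Z1z Zx (xp x Ax).
  have := x0 1 (group1 G); rewrite conjg1 def_x -zz_nat chiz => /eqP i0.
  by case/eqP: ntx; rewrite def_x -zz_nat i0 zz0.
have : a * b^-1 \in K.
  rewrite inE groupM ?groupV //; apply/forall_inP=> g Gg.
  by rewrite conjMg conjVg chiD ?(additive_onV chiD) ?groupV ?nA // eqab // subrr.
by rewrite K1 => /set1gP /eqP; rewrite -eq_mulgV1 => /eqP.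
Qed.

(** The differences of [psi] satisfy the cocycle identity, which [coordinate_inj] turns into the
    derivation identity for the chosen elements [a]. Invariance of [psi] under left translation by
    [a] gives [d (d y) = 1]. *)
Lemma derivation_of_function A chi (psi : gT -> 'F_p) : coordinate A chi ->
    {in G, forall y, exists2 a, a \in A &
       {in G, forall g, chi (a ^ g) = (psi (y * g)%g - psi g)%R
                        /\ psi (a * g) = psi g}} ->
  exists2 h, h \in G & {in G, forall y, [~ y, h] \in A /\
    {in G, forall g, chi ([~ y, h] ^ g) = (psi (y * g)%g - psi g)%R}}.
Proof.
move=> cA; have [/andP[sAG nAG] abA Az chiD chiz] := cA => psiP.
have nA x g : x \in A -> g \in G -> x ^ g \in A.
  by move=> Ax Gg; rewrite memJ_norm // (subsetP nAG).
have [|d dP] := @fin_all_exists gT (fun=> gT) (fun y a => y \in G -> a \in A /\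
       {in G, forall g, chi (a ^ g) = (psi (y * g)%g - psi g)%R
                        /\ psi (a * g) = psi g}).
  move=> y; have [Gy|_] := boolP (y \in G); last by exists 1.
  by have [a Aa aP] := psiP y Gy; exists a.
have dA y : y \in G -> d y \in A by case/dP.
have dE y g : y \in G -> g \in G -> chi (d y ^ g) = (psi (y * g)%g - psi g)%R.
  by case/dP=> _ dE Gg; case: (dE g Gg).
have dG y : y \in G -> d y \in G by move/dA; apply: (subsetP sAG).
have [||h Gh hP] := derivation_inner (d := d).
- move=> x y Gx Gy; have Adxy : d x ^ y \in A by rewrite nA ?dA.
  apply: (coordinate_inj cA); rewrite ?(groupM Adxy) ?dA ?(groupM Gx) //.
  move=> g Gg; rewrite conjMg (chiD _ _ (nA _ _ Adxy Gg) (nA _ _ (dA _ Gy) Gg)) -conjgM.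
  by rewrite !dE ?(groupM Gx) ?(groupM Gy) // mulgA; ring.
- move=> x Gx; split; first exact: dG.
    by have [_ ->] := abelemP pr_p abA; rewrite ?dA.
  apply: (coordinate_inj cA); rewrite ?dA ?dG // => g Gg.
  rewrite conj1g (additive_on1 chiD) dE ?dG //.
  by have [_ /(_ g Gg)[_ ->]] := dP x Gx; rewrite subrr.
by exists h => // y Gy; rewrite -hP //; split=> [|g Gg]; rewrite ?dA ?dE.
Qed.

Lemma der_Phi x y : x \in G -> y \in G -> [~ x, y] \in 'Phi(G).
Proof.
move=> Gx Gy; rewrite (Phi_joing pG); apply: (subsetP (joing_subl _ _)).
exact: mem_commg.
Qed.

Lemma PhiJ x g : x \in 'Phi(G) -> g \in G -> x ^ g \in 'Phi(G).
Proof. by move=> Px Gg; rewrite memJ_norm // (subsetP (normal_norm (Phi_normal G))). Qed.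

Lemma expPhi g : g \in G -> g ^+ p \in 'Phi(G).
Proof. by move=> Gg; rewrite (subsetP sWPhi) ?expW. Qed.

(** * Quadratic functions extending a form on the Frattini subgroup *)

Section Polarization.
Variable phi : gT -> 'F_p.
Hypotheses (phiD : additive_on 'Phi(G) phi) (phiW : {in W, forall w, phi w = 0%R}).

Lemma phiR u g : u \in 'Phi(G) -> g \in G -> phi [~ u, g] = 0%R.
Proof. by move=> Pu Gg; rewrite phiW // (subsetP sPhiGW) // mem_commg. Qed.

Lemma phiJ u g : u \in 'Phi(G) -> g \in G -> phi (u ^ g) = phi u.
Proof.
by move=> Pu Gg; rewrite conjg_mulR phiD ?der_Phi ?phiR ?addr0 // (subsetP sPhiG).
Qed.

(** [phi] is invariant under conjugation because it kills [Phi(G), G], so [phi [~ y, g]] is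
    bilinear. It measures the asymmetry of the polar form of any quadratic extension of [phi]. *)
Lemma phi_commr y : y \in G -> additive_on G (fun g => phi [~ y, g]).
Proof.
move=> Gy g k Gg Gk /=; rewrite commgMJ phiD ?PhiJ ?der_Phi //.
by rewrite phiJ ?der_Phi // addrC.
Qed.

Lemma phi_comml g : g \in G -> additive_on G (fun y => phi [~ y, g]).
Proof.
move=> Gg y k Gy Gk /=; rewrite commMgJ phiD ?PhiJ ?der_Phi //.
by rewrite phiJ ?der_Phi.
Qed.

(* [eps] is quadratic on [H] with polar form [beta], whose right kernel contains
   [S]; bilinearity on the left is a consequence. *)
Definition polarized (H S : {set gT}) (eps : gT -> 'F_p) (beta : gT -> gT -> 'F_p) :=
  [/\ {in H &, forall y g, eps (y * g) = (eps y + eps g + beta y g)%R},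
      {in H & &, forall y g k, beta y (g * k) = (beta y g + beta y k)%R},
      {in 'Phi(G), eps =1 phi}
    & {in H & S, forall y g, beta y g = 0%R}].

(** Expand [eps] on u g = g u^g in both ways; [u ^ g] lies in the right kernel, and this forces [u]
    into the left kernel. *)
Lemma polarized_Phi (H S : {group gT}) eps beta : polarized H S eps beta ->
  'Phi(G) \subset S -> S \subset H -> H \subset G ->
  {in 'Phi(G) & H, forall u g, beta u g = 0%R /\ eps (u * g) = (phi u + eps g)%R}.
Proof.
case=> epsM _ epsP bS sPS sSH sHG u g Pu Hg.
have Su : u \in S by apply: (subsetP sPS).
have Gg : g \in G by apply: (subsetP sHG).
have Hu : u \in H by apply: (subsetP sSH).
have Pug : u ^ g \in 'Phi(G) by apply: PhiJ.
have Sug : u ^ g \in S by apply: (subsetP sPS).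
have e1 := epsM u g Hu Hg.
have e2 := epsM g (u ^ g) Hg (subsetP sSH _ Sug).
rewrite -conjgC e1 (bS _ _ Hg Sug) (epsP _ Pu) (epsP _ Pug) phiJ // addr0 in e2.
have b0 : beta u g = 0%R.
  by apply: (addrI (phi u + eps g)%R); rewrite e2 addr0 addrC.
by split=> //; rewrite e1 b0 epsP ?addr0.
Qed.

(* Every y in <x>H is x^c(y) bar(y) with bar(y) in H; eps' is eps o bar. *)
Lemma polarized_step (H S : {group gT}) eps beta x : polarized H S eps beta ->
    'Phi(G) \subset S -> S \subset H -> H \subset G -> x \in G -> x \notin H ->
  exists eps' beta', polarized (<[x]> <*> H) S eps' beta' /\
    ({in H &, forall y g, beta y g = 0%R} ->
     {in H, forall y, phi [~ x, y] = 0%R} ->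
     {in <[x]> <*> H &, forall y g, beta' y g = 0%R}).
Proof.
move=> pol sPS sSH sHG Gx H'x; have [epsM bD epsP bS] := pol.
have sPH := subset_trans sPS sSH.
have sG'H : G^`(1) \subset H.
  by apply: subset_trans sPH; rewrite (Phi_joing pG) joing_subl.
have nHG : H <| G by apply: sub_der1_normal.
have abGH : p.-abelem (G / H).
  apply/abelemP=> //; split; first exact: sub_der1_abelian.
  move=> _ /morphimP[g Ng Gg ->]; rewrite -morphX //; apply: coset_id.
  by rewrite (subsetP sPH) ?expPhi.
(* [c] reads off the exponent of [x] modulo p. Since [x ^+ c y] uses the representative below p,
   multiplying such powers leaves p-th powers over, which lie in [W]. *)
have [c [cD cH cx]] := additive_on_separate pr_p nHG abGH Gx H'x.
pose bar y := (x ^+ c y)^-1 * y.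
have barK y : y = x ^+ c y * bar y by rewrite /bar mulKVg.
have defH' : <[x]> <*> H = <[x]> * H.
  by rewrite norm_joinEl // cycle_subG (subsetP (normal_norm nHG)).
have sH'G : <[x]> <*> H \subset G by rewrite join_subG cycle_subG Gx.
have xW m : x ^+ (p * m) \in W by rewrite expgM groupX ?expW.
have barH y : y \in <[x]> <*> H -> bar y \in H.
  rewrite defH' => /mulsgP[_ h /cycleP[i ->] Hh def_y].
  have Gh := subsetP sHG h Hh.
  have cy : c y = i%:R%R.
    by rewrite def_y cD ?groupX // (additive_onX _ cD) // cx cH // mulr1 addr0.
  rewrite /bar cy val_Fp_nat // def_y mulgA groupM //.
  rewrite {2}(divn_eq i p) addnC expgD mulKg mulnC.
  by rewrite (subsetP sPH) ?(subsetP sWPhi) ?xW.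
have GH y : y \in <[x]> <*> H -> y \in G by apply: (subsetP sH'G).
have HG y : y \in H -> y \in G by apply: (subsetP sHG).
have PhiH u : u \in 'Phi(G) -> u \in H by apply: (subsetP sPH).
have cM y g : y \in <[x]> <*> H -> g \in <[x]> <*> H -> c (y * g) = (c y + c g)%R.
  by move=> /GH Gy /GH Gg; apply: cD.
have barM y g : y \in <[x]> <*> H -> g \in <[x]> <*> H ->
    exists u, [/\ u \in 'Phi(G), phi u = (c g * phi [~ x, (bar y)^-1])%R
      & bar (y * g) = u * (bar y * bar g)].
  move=> H'y H'g; have Gby := HG _ (barH _ H'y).
  have Gbyv : (bar y)^-1 \in G by rewrite groupV.
  (* The first two factors are the carry of the exponents, an element of [W]; the commutator arises
     from moving [x ^+ c g] to the left past [bar y]. *)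
  exists ((x ^+ c (y * g))^-1 * x ^+ (c y + c g) * [~ x ^+ c g, (bar y)^-1]).
  have wW : (x ^+ c (y * g))^-1 * x ^+ (c y + c g) \in W.
    rewrite cM //; set m := (c y + c g)%N.
    have -> : ((c y + c g)%R : nat) = (m %% p)%N.
      by rewrite -(val_Fp_nat pr_p) /m natrD !Fp_nat_val.
    by rewrite [in x ^+ m](divn_eq m p) addnC expgD mulKg mulnC.
  have Pk : [~ x ^+ c g, (bar y)^-1] \in 'Phi(G) by rewrite der_Phi ?groupX.
  split.
  - by rewrite groupM // (subsetP sWPhi).
  - rewrite phiD ?(subsetP sWPhi _ wW) // (phiW wW) add0r.
    by rewrite (additive_onX _ (phi_comml Gbyv) Gx) Fp_nat_val.
  suff e : y * g = x ^+ c y * x ^+ c g * [~ x ^+ c g, (bar y)^-1] * (bar y * bar g).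
    by rewrite {1}/bar {2}e expgD !mulgA.
  transitivity ((x ^+ c y * bar y) * (x ^+ c g * bar g)); first by rewrite -!barK.
  move: (bar y) (bar g) (x ^+ c y) (x ^+ c g) => a b u w.
  by rewrite commgEl conjgE invgK !mulgA mulgK mulgKV.
have polP := polarized_Phi pol sPS sSH sHG.
exists (eps \o bar), (fun y g => beta (bar y) (bar g) + c g * phi [~ x, (bar y)^-1])%R.
have cS y : y \in H -> c y = 0%R by apply: cH.
have barS y : y \in H -> bar y = y by move=> Hy; rewrite /bar cS // invg1 mul1g.
split; last first.
  move=> b0 x0 y g H'y H'g; rewrite b0 ?barH // x0 ?groupV ?barH //.
  by rewrite mulr0 addr0.
split.
- move=> y g H'y H'g /=; have [u [Pu phiu ->]] := barM y g H'y H'g.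
  have [_ ->] := polP u _ Pu (groupM (barH _ H'y) (barH _ H'g)).
  by rewrite phiu epsM ?barH //; ring.
- move=> y g k H'y H'g H'k /=; have [u [Pu _ ->]] := barM g k H'g H'k.
  have [Hy Hg Hk] := And3 (barH _ H'y) (barH _ H'g) (barH _ H'k).
  rewrite (bD _ _ _ Hy (PhiH _ Pu) (groupM Hg Hk)) (bD _ _ _ Hy Hg Hk).
  by rewrite (bS _ u) ?(subsetP sPS) // cM //; ring.
- by move=> u Pu /=; rewrite barS ?PhiH // epsP.
move=> y g H'y Sg; have Hg := subsetP sSH g Sg.
by rewrite (barS g Hg) (cS g Hg) bS ?barH // mul0r addr0.
Qed.

Lemma polarized_extend (H S : {group gT}) eps beta : polarized H S eps beta ->
  'Phi(G) \subset S -> S \subset H -> H \subset G ->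
  exists eps' beta', polarized G S eps' beta'.
Proof.
have [m] := ubnP (#|G| - #|H|).
elim: m H eps beta => // m IHm H eps beta ltm pol sPS sSH sHG.
have [sGH | /subsetPn[x Gx H'x]] := boolP (G \subset H).
  have -> : G = H by apply: val_inj; apply/eqP; rewrite eqEsubset sGH.
  by exists eps, beta.
have [eps' [beta' [pol' _]]] := polarized_step pol sPS sSH sHG Gx H'x.
have sHH' : H \subset <[x]> <*> H by apply: joing_subr.
have sH'G : <[x]> <*> H \subset G by rewrite join_subG cycle_subG Gx.
apply: (IHm (<[x]> <*> H)%G eps' beta') => //; last exact: subset_trans sHH'.
have ltHH' : #|H| < #|<[x]> <*> H|.
  apply: proper_card; apply/properP; split=> //; exists x => //.
  by rewrite (subsetP (joing_subl _ _)) ?cycle_id.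
rewrite ltnS in ltm; apply: leq_trans ltm.
by rewrite ltn_sub2l // (leq_trans ltHH') // subset_leq_card.
Qed.

(** Start from [phi] with zero polar form and adjoin [v], then [v1]: the polar form stays zero
    because [phi] kills [Phi(G), G] and [[~ v, v1]]. The subgroup reached is then kept in the right
    kernel up to [G]. *)
Lemma polarization v v1 : v \in G -> v1 \in G -> phi [~ v, v1] = 0%R ->
  exists eps beta,
   [/\ {in G &, forall y g, eps (y * g) = (eps y + eps g + beta y g)%R},
       {in G, forall y, additive_on G (beta y)},
       {in 'Phi(G), eps =1 phi},
       {in 'Phi(G) & G, forall u g, beta u g = 0%R}
     & {in G, forall y, beta y v = 0%R /\ beta y v1 = 0%R}].
Proof.
move=> Gv Gv1 v01.
have isotropic (H : {group gT}) x eps beta : polarized H H eps beta ->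
     'Phi(G) \subset H -> H \subset G -> x \in G ->
     {in H, forall y, phi [~ x, y] = 0%R} ->
   exists eps' beta', polarized (<[x]> <*> H) (<[x]> <*> H) eps' beta'.
  move=> pol sPH sHG Gx x0; have [Hx | H'x] := boolP (x \in H).
    exists eps, beta; suff -> : <[x]> <*> H = H by [].
    by apply/joing_idPr; rewrite cycle_subG.
  have [eps' [beta' [[e1 e2 e3 e4] b0]]] := polarized_step pol sPH (subxx _) sHG Gx H'x.
  exists eps', beta'; split=> //; apply: b0 => //; by case: pol.
have pol0 : polarized 'Phi(G) 'Phi(G) phi (fun _ _ => 0%R).
  split=> //; first by move=> y g Py Pg; rewrite phiD // addr0.
  by move=> *; rewrite addr0.
have phiC x y : x \in G -> y \in G -> phi [~ x, y] = (- phi [~ y, x])%R.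
  by move=> Gx Gy; rewrite -invg_comm (additive_onV phiD) ?der_Phi.
have [||||e1 [b1 pol1]] := isotropic _ v _ _ pol0 => //.
  by move=> y Py; have Gy := subsetP sPhiG y Py; rewrite phiC // phiR // oppr0.
have sP1 : 'Phi(G) \subset <[v]> <*> 'Phi(G) by apply: joing_subr.
have s1G : <[v]> <*> 'Phi(G) \subset G by rewrite join_subG cycle_subG Gv.
have [||||e2 [b2 pol2]] := isotropic (<[v]> <*> 'Phi(G))%G v1 _ _ pol1 => //.
  move=> y /=; rewrite norm_joinEl; last first.
    by rewrite cycle_subG (subsetP (normal_norm (Phi_normal G))).
  case/mulsgP=> _ u /cycleP[i ->] Pu ->.
  have Gu : u \in G by apply: (subsetP sPhiG).
  rewrite /= (phi_commr Gv1 (groupX i Gv) Gu) /=.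
  rewrite (additive_onX i (phi_commr Gv1) Gv) /= (phiC v1 v) // v01.
  by rewrite (phiC v1 u) // phiR // !oppr0 mulr0 addr0.
have sP2 : 'Phi(G) \subset <[v1]> <*> (<[v]> <*> 'Phi(G)).
  exact: subset_trans sP1 (joing_subr _ _).
have s2G : <[v1]> <*> (<[v]> <*> 'Phi(G)) \subset G by rewrite join_subG cycle_subG Gv1.
have [eps [beta pol]] := polarized_extend (H := <[v1]> <*> (<[v]> <*> 'Phi(G)))
  (S := <[v1]> <*> (<[v]> <*> 'Phi(G))) pol2 sP2 (subxx _) s2G.
have polP := polarized_Phi pol sP2 s2G (subxx _).
have [epsM bD epsP bS] := pol; exists eps, beta; split=> //.
- by move=> y Gy g k Gg Gk; apply: bD.
- by move=> u g Pu Gg; case: (polP u g Pu Gg).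
move=> y Gy; split; apply: bS => //.
  by rewrite (subsetP (joing_subr _ _)) // (subsetP (joing_subl _ _)) ?cycle_id.
by rewrite (subsetP (joing_subl _ _)) ?cycle_id.
Qed.
End Polarization.
(** * Elements of low degree *)

Definition lam (u : 'cV['F_p]_n) (g : gT) : 'F_p := (rho g *m u)%R 0%R 0%R.

Lemma lam_additive u : additive_on G (lam u).
Proof. by move=> x y Gx Gy; rewrite /lam rhoM // mulmxDl mxE. Qed.

Lemma lamD u u' g : lam (u + u')%R g = (lam u g + lam u' g)%R.
Proof. by rewrite /lam mulmxDr mxE. Qed.

Lemma lamZ a u g : lam (a *: u)%R g = (a * lam u g)%R.
Proof. by rewrite /lam -scalemxAr mxE. Qed.

Lemma lamN u g : lam (- u)%R g = (- lam u g)%R.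
Proof. by rewrite -scaleN1r lamZ mulN1r. Qed.

Lemma lam0 g : lam 0%R g = 0%R.
Proof. by rewrite /lam mulmx0 mxE. Qed.

Lemma lam1 u : lam u 1 = 0%R.
Proof. exact: additive_on1 (@lam_additive u). Qed.

Lemma lam_Phi u g : g \in 'Phi(G) -> lam u g = 0%R.
Proof. exact: (additive_on_Phi pr_p pG (@lam_additive u)). Qed.

Lemma lam_onto u a : u != 0%R -> exists2 g, g \in G & lam u g = a.
Proof.
move=> u0; have [i ui] : exists i, u i 0%R != 0%R.
  apply/existsP; apply: contraNT u0; rewrite negb_exists => /forallP u0.
  apply/eqP/matrixP=> i j; rewrite (ord1 j) mxE; apply/eqP.
  by rewrite -[_ == _]negbK u0.
have [g Gg rg] := rho_onto ((a / u i 0) *: delta_mx 0 i)%R.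
exists g => //; rewrite /lam rg -scalemxAl mxE -rowE mxE.
by rewrite divfK.
Qed.

Lemma lam_separates g : g \in G -> (forall u, lam u g = 0%R) -> g \in 'Phi(G).
Proof.
move=> Gg lam0; apply: rho_inj => //; apply/rowP=> i; rewrite mxE.
by have := lam0 (delta_mx i 0)%R; rewrite /lam -colE mxE.
Qed.

Lemma hom_lam f : additive_on G f -> exists u, {in G, f =1 lam u}.
Proof.
move=> fD; have [|s sP] := @fin_all_exists 'rV['F_p]_n (fun=> gT)
    (fun r g => g \in G /\ rho g = r).
  by move=> r; have [g Gg rg] := rho_onto r; exists g.
have sG r : s r \in G by case: (sP r).
have sE r : rho (s r) = r by case: (sP r).
have fs x y : x \in G -> y \in G -> rho x = rho y -> f x = f y.
  move=> Gx Gy rxy; have rV : rho y^-1 = (- rho y)%R.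
    apply/eqP; rewrite -addr_eq0 -rhoM ?groupV // mulVg.
    have := rhoM (group1 G) (group1 G); rewrite mulg1 => /eqP.
    by rewrite -subr_eq0 opprD addNKr oppr_eq0.
  have Pxy : x * y^-1 \in 'Phi(G).
    by rewrite rho_inj ?groupM ?groupV // rhoM ?groupV // rV rxy subrr.
  have := additive_on_Phi pr_p pG fD Pxy.
  by rewrite fD ?groupV // (additive_onV fD) // => /eqP; rewrite subr_eq0 => /eqP.
have [|u uP] := @additive_rV p pr_p n (f \o s).
  by move=> a b /=; rewrite -fD //; apply: fs; rewrite ?groupM // rhoM // !sE.
by exists u => g Gg; rewrite /lam -uP /=; apply: fs; rewrite ?sE.
Qed.

(** Biduality: this is how the linear obstructions given by [theta] become the points [v0] and [v1]
    of [G]. *)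
Lemma lam_functional (c : 'cV['F_p]_n -> 'F_p) : {morph c : u v / (u + v)%R} ->
  exists2 v, v \in G & forall u, c u = lam u v.
Proof.
move=> cD; have [r rP] := additive_cV pr_p cD; have [v Gv rv] := rho_onto r.
by exists v => // u; rewrite rP /lam rv.
Qed.

(** * The module Omega_1(C_G(Phi(G))) and the obstruction [theta] *)

Let E := 'Ohm_1(C).

Let abC : abelian C.
Proof. by apply: subset_trans (subsetIr _ _) (centS sCPhi). Qed.

Let pC : p.-group C. Proof. exact: pgroupS sCG pG. Qed.

Let nCG : C <| G.
Proof.
have := subcent_normal G 'Phi(G).
by rewrite (setIidPl (normal_norm (Phi_normal G))).
Qed.

Let nEG : E <| G. Proof. exact: char_normal_trans (Ohm_char 1 _) nCG. Qed.

Let abE : p.-abelem E. Proof. exact: Ohm1_abelem. Qed.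

Lemma mem_E x : (x \in E) = (x \in C) && (x ^+ p == 1).
Proof.
have -> : E = 'Ldiv_(p ^ 1)(C) by apply: (OhmEabelian pC); apply: abelem_abelian abE.
by rewrite !inE expn1.
Qed.

Let sEC : E \subset C. Proof. exact: Ohm_sub. Qed.

Lemma centC x y : x \in C -> y \in 'Phi(G) -> commute x y.
Proof. by case/setIP=> _ /centP cx /cx. Qed.

Lemma commC x y : x \in C -> y \in C -> commute x y.
Proof. by move=> Cx Cy; apply: centC => //; apply: (subsetP sCPhi). Qed.

Lemma ZC x : x \in 'Z(G) -> x \in C.
Proof.
by case/setIP=> Gx cx; rewrite inE Gx (subsetP (centS sPhiG)).
Qed.

Let Ez : z \in E. Proof. by rewrite mem_E ZC // -oz expg_order eqxx. Qed.

Lemma zzE a : zz a \in E. Proof. exact: groupX. Qed.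

Lemma EJ x g : x \in E -> g \in G -> x ^ g \in E.
Proof. by move=> Ex Gg; rewrite memJ_norm // (subsetP (normal_norm nEG)). Qed.

Lemma EC x : x \in E -> x \in C. Proof. exact: (subsetP sEC). Qed.

Lemma EPhi x : x \in E -> x \in 'Phi(G). Proof. by move/EC; apply: (subsetP sCPhi). Qed.

Lemma EG x : x \in E -> x \in G. Proof. by move/EC; apply: (subsetP sCG). Qed.

Lemma coordinate_extend (A B : {group gT}) chi : A <| G -> p.-abelem A -> B \subset A ->
    z \in B -> additive_on B chi -> (forall a, chi (zz a) = a) ->
  exists2 chi', coordinate A chi' & {in B, chi' =1 chi}.
Proof.
move=> nAG abA sBA Bz chiD chiz.
have [chi' chi'D chi'E] := additive_on_extend abA sBA chiD.
exists chi' => //; split=> //; first exact: (subsetP sBA).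
by move=> a; rewrite chi'E ?groupX.
Qed.

Lemma coordinateE_exists : exists chi, coordinate E chi.
Proof.
have dz : p %| #[z] by rewrite oz.
have [||chi cE _] := coordinate_extend nEG abE _ (cycle_id z) (dlog_additive pr_p dz).
- by rewrite cycle_subG.
- by move=> a; rewrite dlogX // Fp_nat_val.
by exists chi.
Qed.

(* For m^p in Z(G), [theta m] vanishes iff m can be corrected by an element of
   Z(G) to an element of order dividing p. *)
Let theta (m : gT) := dlog p z0 (m ^+ p).

Let dvd_z0 : p %| #[z0].
Proof. by rewrite -oz [#[z0]]/order -defZ order_dvdG. Qed.

Lemma theta_center m : m \in 'Z(G) -> theta m = 0%R.
Proof.
rewrite defZ => Zm.
by rewrite /theta (additive_onX _ (dlog_additive pr_p dvd_z0)) // Fp_natr_p // mul0r.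
Qed.

Lemma theta0 m : m \in G -> m ^+ p \in 'Z(G) -> theta m = 0%R ->
  exists2 y, y \in 'Z(G) & (m * y) ^+ p = 1.
Proof.
move=> Gm; rewrite defZ => Zm /(dlog0 pr_p dvd_z0 Zm)[y Zy def_m].
exists y^-1; first by rewrite groupV.
have /centerP[_ cy] : y^-1 \in 'Z(G) by rewrite defZ groupV.
by rewrite expgMn; [rewrite def_m expgVn mulgV | apply/esym/cy].
Qed.

(** * Functions on G represented by elements of E or realized by elements of C *)

Section Coordinate.
Variable chi : gT -> 'F_p.
Hypothesis cE : coordinate E chi.

Let chiD : additive_on E chi. Proof. by case: cE. Qed.
Let chiz a : chi (zz a) = a. Proof. by case: cE. Qed.

Definition represents a (f : gT -> 'F_p) :=
  a \in E /\ {in G, forall g, chi (a ^ g) = f g}.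

(* [m] induces the same derivation as the function [f], but, unlike an element
   representing [f] up to a constant, it need not have order p. *)
Definition realizes m (f : gT -> 'F_p) :=
  m \in C /\ {in G, forall g, [~ m, g] \in E /\ chi [~ m, g] = f g}.

Lemma representsJ a f g : represents a f -> g \in G ->
  {in G, f =1 f \o mulg g} -> a ^ g = a.
Proof.
case=> Ea fE Gg fg; apply: (coordinate_inj cE) => //; first exact: EJ.
by move=> y Gy; rewrite -conjgM !fE ?groupM //; apply/esym/fg.
Qed.

Lemma commMC x y g : x \in C -> y \in C -> g \in G ->
  [~ x * y, g] = [~ x, g] * [~ y, g].
Proof.
move=> Cx Cy Gg; rewrite commMgJ; congr (_ * _).
apply/conjg_fixP/commgP/commC => //; rewrite commgEl groupM ?groupV //.
by rewrite memJ_norm // (subsetP (normal_norm nCG)).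
Qed.

Lemma realizesM m m' f f' : realizes m f -> realizes m' f' ->
  realizes (m * m') (fun g => f g + f' g)%R.
Proof.
case=> Cm mf [Cm' mf']; split; first exact: groupM.
move=> g Gg; rewrite commMC //.
have [[Em <-] [Em' <-]] := (mf g Gg, mf' g Gg).
by rewrite groupM // chiD.
Qed.

Lemma realizesJ m f y g : realizes m f -> y \in G -> g \in G ->
  chi ([~ m, y] ^ g) = (f (y * g)%g - f g)%R.
Proof.
case=> Cm mf Gy Gg; have [[Emy _] [Emg fg]] := (mf y Gy, mf g Gg).
have [_ <-] := mf (y * g) (groupM Gy Gg).
by rewrite commgMJ (chiD Emg (EJ Emy Gg)) fg; ring.
Qed.

Lemma realizes_uniq m m' f : realizes m f -> realizes m' f -> m * m'^-1 \in 'Z(G).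
Proof.
move=> mf mf'; have [[Cm _] [Cm' _]] := (mf, mf').
have Gmm' : m * m'^-1 \in G by rewrite (subsetP sCG) ?groupM ?groupV.
apply/centerP; split=> // g Gg; apply/commgP.
have e : [~ m, g] = [~ m', g].
  case: (mf) => _ /(_ g Gg)[Em _]; case: (mf') => _ /(_ g Gg)[Em' _].
  apply: (coordinate_inj cE) => // y Gy.
  by rewrite (realizesJ mf) // (realizesJ mf').
have /eqP := comm1g g; rewrite -(mulgV m') !commMC ?groupV //.
by rewrite e.
Qed.

(** [[~ m, g]] has order dividing p and commutes with [m], as [C] is abelian. Hence [theta m] is
    meaningful. *)
Lemma realizes_expp m f : realizes m f -> m ^+ p \in 'Z(G).
Proof.
case=> Cm mf; apply/centerP; split=> [|g Gg]; first by rewrite groupX ?(subsetP sCG).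
have [Em _] := mf g Gg; apply/commgP; rewrite commXg; last exact: commC (EC Em).
by move: Em; rewrite mem_E => /andP[_].
Qed.

Lemma thetaM x y : x \in C -> y \in C -> x ^+ p \in 'Z(G) -> y ^+ p \in 'Z(G) ->
  theta (x * y) = (theta x + theta y)%R.
Proof.
move=> Cx Cy; rewrite defZ => Zx Zy; rewrite /theta expgMn; last exact: commC.
exact: (dlog_additive pr_p dvd_z0).
Qed.

Lemma theta_uniq m m' f : realizes m f -> realizes m' f -> theta m = theta m'.
Proof.
move=> mf mf'; have Zmm' := realizes_uniq mf mf'.
have [[Cm _] [Cm' _]] := (mf, mf').
have := thetaM (ZC Zmm') Cm' (groupX p Zmm') (realizes_expp mf').
by rewrite mulgKV (theta_center Zmm') add0r.
Qed.

Lemma realizes_ext m f f' : realizes m f -> {in G, f =1 f'} -> realizes m f'.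
Proof.
by case=> Cm mf ff'; split=> // g Gg; have [Em ->] := mf g Gg; rewrite ff'.
Qed.

(** When [theta m] vanishes, a central factor makes [m] of order dividing p, so that it represents
    [f] up to a constant; a power of [z] adjusts the constant. *)
Lemma represents_of_realizes m f c : realizes m f -> theta m = 0%R ->
  exists a, represents a (fun g => f g + c)%R.
Proof.
move=> mf tm; have [Cm mfE] := mf; have Gm := subsetP sCG m Cm.
have [y Zy my] := theta0 Gm (realizes_expp mf) tm.
have Emy : m * y \in E by rewrite mem_E my eqxx andbT groupM ?(ZC Zy).
exists (m * y * zz (c - chi (m * y))%R); split; first by rewrite groupM ?zzE.
move=> g Gg; have [Em <-] := mfE g Gg.
have cyg : [~ y, g] = 1 by apply/eqP/commgP; case/centerP: Zy => _; apply.
have emy : [~ m * y, g] = [~ m, g] by rewrite commMC ?(ZC Zy) // cyg mulg1.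
rewrite conjMg zzJ // (chiD (EJ Emy Gg) (zzE _)) chiz conjg_mulR emy.
by rewrite (chiD Emy Em); ring.
Qed.

Lemma realizes_hom u : exists k, realizes k (lam u) /\
  {in G, forall g, [~ k, g] = zz (lam u g)}.
Proof.
have [k Ck kE] := hom_inner (@lam_additive u).
by exists k; split=> //; split=> // g Gg; rewrite kE // chiz zzE.
Qed.

(** Two elements realizing the same function differ by a central one, so [theta] depends on [u]
    alone, and additively. *)
Lemma theta_hom : exists2 v0, v0 \in G &
  forall k u, realizes k (lam u) -> theta k = lam u v0.
Proof.
have [|kap kapP] := @fin_all_exists 'cV['F_p]_n (fun=> gT) (fun u k => realizes k (lam u)).
  by move=> u; have [k [ku _]] := realizes_hom u; exists k.
have [|v0 Gv0 v0E] := @lam_functional (theta \o kap).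
  move=> u v /=; have [ru rv] := (kapP u, kapP v); have [[Cu _] [Cv _]] := (ru, rv).
  rewrite -thetaM ?(realizes_expp ru) ?(realizes_expp rv) //.
  apply: (theta_uniq (kapP _)); apply: realizes_ext (realizesM ru rv) _.
  by move=> g _; rewrite lamD.
exists v0 => // k u ku; rewrite -v0E; exact: theta_uniq ku (kapP u).
Qed.


Lemma represents_eq a b f : represents a f -> represents b f -> a = b.
Proof.
by case=> Ea fa [Eb fb]; apply: (coordinate_inj cE) => // g Gg; rewrite fa ?fb.
Qed.

Lemma represents_zz c : represents (zz c) (fun=> c).
Proof. by split=> [|g Gg]; rewrite ?zzE // zzJ. Qed.

Lemma represents_ext a f f' : represents a f -> {in G, f =1 f'} -> represents a f'.
Proof. by case=> Ea fE ff'; split=> // g Gg; rewrite fE ?ff'. Qed.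

Lemma commVg_conj (x y : gT) : [~ x^-1, y] = [~ y, x] ^ x^-1.
Proof. by rewrite !commgEl !conjgE !invgK !mulgA mulgK. Qed.

Lemma half_add : (2^-1 + 2^-1 = 1 :> 'F_p)%R.
Proof.
have two : (2%:R != 0 :> 'F_p)%R.
  rewrite -(dvdn_pcharf (pchar_Fp pr_p)); apply: contraL odd_p => /dvdn_leq.
  by case: p pr_p => [|[|[|q]]] // _ /(_ isT).
by apply: (mulfI two); rewrite mulrDr divff // mulr1.
Qed.

(* By [theta_hom], theta is evaluation at some v0 on the elements realizing
   homomorphisms, so those vanishing at v0 are represented in [E]. *)
Section Exponent.
Variable v0 : gT.
Hypotheses (Gv0 : v0 \in G).
Hypothesis v0E : forall k u, realizes k (lam u) -> theta k = lam u v0.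

Lemma represents_lam u c : lam u v0 = 0%R ->
  exists a, represents a (fun g => lam u g + c)%R.
Proof.
move=> uv0; have [k [ku _]] := realizes_hom u.
by apply: (represents_of_realizes _ ku); rewrite (v0E ku).
Qed.

(** The differences of the product have degree 1 with linear part vanishing at [v0], so they are
    represented in [E]. *)
Lemma realizes_mul u1 u2 : lam u1 v0 = 0%R -> lam u2 v0 = 0%R ->
  exists m, realizes m (fun g => lam u1 g * lam u2 g)%R.
Proof.
move=> u1v u2v; set psi := fun g : gT => (lam u1 g * lam u2 g)%R.
have psiE y : y \in G -> {in G, forall g, (psi (y * g)%g - psi g =
    lam (lam u1 y *: u2 + lam u2 y *: u1) g + lam u1 y * lam u2 y)%R}.
  by move=> Gy g Gg; rewrite /psi !lam_additive // lamD !lamZ; ring.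
have [|h Gh hP] := derivation_of_function (psi := psi) cE.
  move=> y Gy; have [|a [Ea aE]] := @represents_lam
      (lam u1 y *: u2 + lam u2 y *: u1)%R (lam u1 y * lam u2 y)%R.
    by rewrite lamD !lamZ u1v u2v !mulr0 addr0.
  exists a => // g Gg; rewrite aE // psiE //; split=> //.
  by rewrite /psi !(lam_additive _ (EG Ea) Gg) !(lam_Phi _ (EPhi Ea)) !add0r.
have Ch : h \in C.
  rewrite inE Gh; apply/centP=> y Py; have Gy := subsetP sPhiG y Py.
  have [Eyh yhE] := hP y Gy; apply/commgP/eqP; rewrite -invg_comm.
  suff -> : [~ y, h] = 1 by rewrite invg1.
  apply: (coordinate_inj cE) => // g Gg.
  by rewrite yhE // conj1g (additive_on1 chiD) psiE // lamD !lamZ !(lam_Phi _ Py) !mul0r !addr0.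
(* Inverting [h] passes from [[~ g, h]] to the commutator with the group element on the right. *)
exists h^-1; split=> [|g Gg]; first by rewrite groupV.
have [Egh ghE] := hP g Gg; rewrite commVg_conj.
have -> : [~ g, h] ^ h^-1 = [~ g, h].
  by apply/conjg_fixP/commgP/commC; [exact: EC | rewrite groupV].
split=> //; rewrite -[[~ g, h]]conjg1 ghE // mulg1 /psi.
by rewrite !lam1 mulr0 subr0.
Qed.

(* The square of lam u is realized by an m in Phi(G), so that [m, y] lies in W. *)
Lemma represents_lam_W a u c : lam u v0 = 0%R ->
  represents a (fun g => lam u g + c)%R -> a \in W.
Proof.
move=> uv aE; have zzW b : zz b \in W by rewrite groupX.
have [u0 | u0] := eqVneq u 0%R.
  rewrite (_ : a = zz c) //; apply: represents_eq aE _.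
  by apply: represents_ext (represents_zz c) _ => g _; rewrite u0 lam0 add0r.
have [y Gy uy] := lam_onto (2^-1)%R u0.
have [m mP] := realizes_mul uv uv; have [Cm /(_ y Gy)[Emy _]] := mP.
have Wmy : [~ m, y] \in W by rewrite (subsetP sPhiGW) ?mem_commg // (subsetP sCPhi).
have -> : a = [~ m, y] * zz (c - 2^-1 * 2^-1)%R; last by rewrite groupM.
apply: represents_eq aE _; split=> [|g Gg]; first by rewrite groupM ?zzE.
rewrite conjMg zzJ // (chiD (EJ Emy Gg) (zzE _)) chiz (realizesJ mP) //.
rewrite !lam_additive // uy; move: (2^-1)%R half_add => b bb.
by transitivity ((b + b) * lam u g + c)%R; [ring | rewrite bb mul1r].
Qed.

(** The element representing [lam u] lies in [W], hence is fixed by [g]; comparing its coordinates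
    at [g] and at 1 gives the claim. *)
Lemma lam_centW g u : g \in 'C_G(W) -> lam u v0 = 0%R -> lam u g = 0%R.
Proof.
case/setIP=> Gg /centP cg uv; have [a aP] := represents_lam 0%R uv.
have Wa := represents_lam_W uv aP; have [Ea aE] := aP.
have := aE g Gg; rewrite /conjg -cg // mulKg.
by have := aE 1 (group1 G); rewrite conjg1 lam1 add0r addr0 => -> <-.
Qed.

(** [t] induces a quadratic derivation: [ub y] and [eps y] are the linear part and the constant term
    of the function representing [[~ t, y]]. *)
Definition low t (eps : gT -> 'F_p) (ub : gT -> 'cV['F_p]_n) :=
  t \in 'C_G(W) /\ {in G, forall y, [/\ [~ t, y] \in W,
    represents [~ t, y] (fun g => lam (ub y) g + eps y)%R & lam (ub y) v0 = 0%R]}.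

(** Take the quadratic extension of [phi] with [v0] and [v1] in the right kernel of its polar form.
    Vanishing at [v0] makes its differences representable; on Phi(G) only the constants [phi y]
    remain. *)
Lemma low_exists phi v1 : additive_on 'Phi(G) phi -> {in W, forall w, phi w = 0%R} ->
    v1 \in G -> phi [~ v0, v1] = 0%R ->
  exists t eps ub, [/\ low t eps ub, {in G, forall y, lam (ub y) v1 = 0%R}
    & {in 'Phi(G), forall y, [~ t, y] = zz (phi y)}].
Proof.
move=> phiD phiW Gv1 phiv.
have [eps [beta [epsM bD epsP bP bv]]] := polarization phiD phiW Gv0 Gv1 phiv.
have [|ub ubE] := @fin_all_exists gT (fun=> 'cV['F_p]_n)
    (fun y u => y \in G -> {in G, beta y =1 lam u}).
  move=> y; have [Gy|_] := boolP (y \in G); last by exists 0%R.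
  by have [u uE] := hom_lam (bD y Gy); exists u.
have ubv y : y \in G -> lam (ub y) v0 = 0%R /\ lam (ub y) v1 = 0%R.
  by move=> Gy; rewrite -!ubE //; apply: bv.
have epsE y : y \in G -> {in G, forall g, (eps (y * g)%g - eps g = lam (ub y) g + eps y)%R}.
  by move=> Gy g Gg; rewrite epsM // ubE //; ring.
have [|h Gh hP] := derivation_of_function (psi := eps) cE.
  move=> y Gy; have [uv0 uv1] := ubv y Gy.
  have [a aP] := represents_lam (eps y) uv0; have [Ea aE] := aP.
  have Wa := represents_lam_W uv0 aP; have Pa := subsetP sWPhi a Wa.
  exists a => // g Gg; rewrite aE // epsE //; split=> //.
  by rewrite (epsM _ _ (EG Ea) Gg) bP // epsP // phiW // add0r addr0.
have hE y : y \in G -> represents [~ y, h] (fun g => lam (ub y) g + eps y)%R.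
  by move=> Gy; have [Ey yE] := hP y Gy; split=> // g Gg; rewrite yE ?epsE.
have Wh y : y \in G -> [~ y, h] \in W.
  by move=> Gy; apply: represents_lam_W (hE y Gy); case: (ubv y Gy).
have Ph y : y \in 'Phi(G) -> [~ y, h] = zz (phi y).
  move=> Py; have Gy := subsetP sPhiG y Py; apply: represents_eq (hE y Gy) _.
  apply: represents_ext (represents_zz _) _ => g Gg.
  by rewrite -ubE // bP // add0r epsP.
have ch : h \in 'C(W).
  apply/centP=> w Ww; apply/esym/commgP; rewrite Ph ?phiW ?zz0 //.
  exact: (subsetP sWPhi).
have hV y : y \in G -> [~ h^-1, y] = [~ y, h].
  move=> Gy; rewrite commVg_conj; apply/conjg_fixP/commgP/esym.
  by apply: (centP _ _ (Wh y Gy)); rewrite groupV.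
exists h^-1, eps, ub; split.
- split; first by rewrite inE !groupV Gh.
  by move=> y Gy; rewrite hV //; split; [exact: Wh | exact: hE | case: (ubv y Gy)].
- by move=> y Gy; case: (ubv y Gy).
by move=> y Py; rewrite hV ?Ph // (subsetP sPhiG).
Qed.


(** As in [theta_hom], [theta] is additive in [u], here on the forms vanishing at [v0] only; it is
    extended to all forms through the projection [pr]. *)
Lemma theta_mul um : lam um v0 = 0%R -> exists2 v1, v1 \in G &
  forall m u, lam u v0 = 0%R -> realizes m (fun g => lam um g * lam u g)%R ->
    theta m = lam u v1.
Proof.
move=> umv; have [u0 u0P] : exists u0, forall u, lam (u - lam u v0 *: u0)%R v0 = 0%R.
  have [/forallP z0v | /forallPn[u uv]] := boolP [forall u, lam u v0 == 0%R].
    by exists 0%R => u; rewrite scaler0 subr0; apply/eqP.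
  exists ((lam u v0)^-1 *: u)%R => u'.
  by rewrite lamD lamN !lamZ mulVf // mulr1 subrr.
pose pr u := (u - lam u v0 *: u0)%R.
have [|kap kapP] := @fin_all_exists 'cV['F_p]_n (fun=> gT)
    (fun u m => realizes m (fun g => lam um g * lam (pr u) g)%R).
  by move=> u; apply: realizes_mul; last exact: u0P.
have [|v1 Gv1 v1E] := @lam_functional (theta \o kap).
  move=> u v /=; have [ru rv] := (kapP u, kapP v); have [[Cu _] [Cv _]] := (ru, rv).
  rewrite -thetaM ?(realizes_expp ru) ?(realizes_expp rv) //.
  apply: (theta_uniq (kapP _)); apply: realizes_ext (realizesM ru rv) _.
  by move=> g _; rewrite /pr !lamD !lamN !lamZ; ring.
exists v1 => // m u uv mP; rewrite -v1E; apply: (theta_uniq mP).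
by apply: realizes_ext (kapP u) _ => g _; rewrite /pr uv scale0r subr0.
Qed.

Lemma lowM t t' eps eps' ub ub' : low t eps ub -> low t' eps' ub' ->
  low (t * t') (fun y => eps y + eps' y)%R (fun y => ub y + ub' y)%R.
Proof.
case=> ct tP [ct' tP']; split=> [|y Gy]; first exact: groupM.
have [[Wty [Ety tE] uv] [Wty' [Ety' tE'] uv']] := (tP y Gy, tP' y Gy).
have -> : [~ t * t', y] = [~ t, y] * [~ t', y].
  rewrite commMgJ; congr (_ * _); apply/conjg_fixP/commgP/esym.
  by case/setIP: ct' => _ /centP; apply.
split; [exact: groupM | | by rewrite lamD uv uv' addr0].
split=> [|g Gg]; first exact: groupM.
by rewrite conjMg (chiD (EJ Ety Gg) (EJ Ety' Gg)) tE // tE' // lamD; ring.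
Qed.

Lemma lowX t eps ub j : low t eps ub ->
  low (t ^+ j) (fun y => j%:R * eps y)%R (fun y => j%:R *: ub y)%R.
Proof.
move=> lt; have [ct _] := lt; elim: j => [|j [_ IHj]].
  split=> [|y Gy]; first exact: group1.
  rewrite expg0 comm1g scale0r lam0 -zz0; split; rewrite ?groupX //.
  apply: represents_ext (represents_zz 0%R) _ => g Gg.
  by rewrite lam0 mul0r addr0.
have [ct' tP] := lowM lt (conj (groupX j ct) IHj).
rewrite expgS; split=> // y Gy; have [Wty tyE uv] := tP y Gy; split=> //.
  apply: represents_ext tyE _ => g Gg.
  by rewrite lamD !lamZ -!natr1; ring.
by move: uv; rewrite lamD !lamZ -natr1 mulrDl mul1r addrC.
Qed.

Lemma low_center y : y \in 'Z(G) -> low y (fun=> 0%R) (fun=> 0%R).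
Proof.
move=> Zy; have /centerP[Gy cy] := Zy; split=> [|g Gg].
  by rewrite inE Gy; apply/centP=> w Ww; apply: cy; apply: (subsetP sWG).
have -> : [~ y, g] = 1 by apply/eqP/commgP/cy.
rewrite -zz0 lam0; split=> //; first by rewrite groupX.
by apply: represents_ext (represents_zz 0%R) _ => x Gx; rewrite lam0 addr0.
Qed.

Lemma low_expp t eps ub : low t eps ub -> t ^+ p \in 'Z(G).
Proof.
case=> /setIP[Gt /centP ct] tP; apply/centerP; split=> [|g Gg]; first exact: groupX.
have [Wtg [Etg _] _] := tP g Gg; apply/commgP; rewrite commXg; last exact: ct.
by move: Etg; rewrite mem_E => /andP[_].
Qed.

(** The power [j] is chosen so that [theta] vanishes on [t * s ^+ j]; the central [y] then makes the
    order divide p. *)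
Lemma low_adjust t s eps eps' ub ub' : low t eps ub -> low s eps' ub' ->
    [~ s, t] \in 'Z(G) -> theta s != 0%R ->
  exists j y eps2, [/\ y \in 'Z(G), (t * s ^+ j * y) ^+ p = 1 &
    low (t * s ^+ j * y) eps2 (fun g => ub g + j%:R *: ub' g)%R].
Proof.
move=> lt ls Zst ths; have Zt := low_expp lt; have Zs := low_expp ls.
have [[/setIP[Gt _] _] [/setIP[Gs _] sP]] := (lt, ls).
pose j : nat := (- (theta t / theta s))%R : 'F_p.
have jE : (j%:R = - (theta t / theta s))%R by rewrite Fp_nat_val.
have cst x : x \in G -> commute x [~ s, t].
  by move=> Gx; have /centerP[_ cx] := Zst; apply/esym/cx.
have csjt : [~ s ^+ j, t] = [~ s, t] ^+ j by rewrite commXg //; apply: cst.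
(* With a central commutator, the p-th power of the product is corrected by [[~ s, t]] to a multiple
   of binomial(p, 2), which is divisible by p as p is odd; and [[~ s, t]] lies in [E]. *)
have tsp : (t * s ^+ j) ^+ p = t ^+ p * (s ^+ p) ^+ j.
  rewrite expMg_Rmul csjt; try by apply/commuteX/cst; rewrite ?groupX.
  rewrite -!expgM [(j * p)%N]mulnC bin2odd // mulnCA !expgM.
  have [_ [Est _] _] := sP t Gt; move: Est; rewrite mem_E => /andP[_ /eqP ->].
  by rewrite !expg1n mulg1.
have Zts : (t * s ^+ j) ^+ p \in 'Z(G) by rewrite tsp; apply: groupM => //; apply: groupX.
have [||y Zy yp] := theta0 _ Zts; first by rewrite groupM ?groupX.
  have zD := dlog_additive pr_p dvd_z0; move: Zt Zs; rewrite /theta tsp defZ => Zt Zs.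
  rewrite (zD _ _ Zt (groupX j Zs)) (additive_onX j zD Zs) jE -/(theta t) -/(theta s).
  by rewrite mulNr divfK // subrr.
have [ctsy tsyP] := lowM (lowM lt (lowX j ls)) (low_center Zy).
exists j, y, (fun g => eps g + j%:R * eps' g + 0)%R; split=> //.
split=> // g Gg; have [Wg gE uv] := tsyP g Gg; split=> //.
  by apply: represents_ext gE _ => x Gx; rewrite addr0.
by rewrite addr0 in uv.
Qed.

(** After expansion the quadratic part contributes [lam u v1] to [theta] and the linear part
    [lam s v0], as [um] and [u] vanish at [v0]; by the last hypothesis these cancel. *)
Lemma represents_mul_lam um u s v1 b e c : lam um v0 = 0%R -> lam u v0 = 0%R ->
    (forall m u', lam u' v0 = 0%R -> realizes m (fun g => lam um g * lam u' g)%R ->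
      theta m = lam u' v1) ->
    (lam s v0 + lam u v1 = 0)%R ->
  exists a, represents a (fun g => (b + lam um g) * (lam u g + e) + (lam s g + c))%R.
Proof.
move=> umv uv v1E sv; have [m mP] := realizes_mul umv uv.
have [k [kP _]] := realizes_hom (e *: um + b *: u + s)%R.
have [[Cm _] [Ck _]] := (mP, kP).
have th0 : theta (m * k) = 0%R.
  rewrite thetaM ?(realizes_expp mP) ?(realizes_expp kP) // (v1E m u uv mP) (v0E kP).
  by rewrite !lamD !lamZ umv uv !mulr0 !add0r addrC.
have [a aP] := represents_of_realizes (b * e + c)%R (realizesM mP kP) th0.
by exists a; apply: represents_ext aP _ => g Gg; rewrite !lamD !lamZ; ring.
Qed.

(* The quadratic [q] compensates the values of theta, on the quadratic functions
   lam um * lam u, recorded by [v1]. *)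
Section FinalDerivation.
Variables (t v1 : gT) (um : 'cV['F_p]_n).
Variables (eps q : gT -> 'F_p) (ub sb : gT -> 'cV['F_p]_n).
Hypotheses (lt : low t eps ub) (tp : t ^+ p = 1) (umv : lam um v0 = 0%R).
Hypothesis v1E : forall m u, lam u v0 = 0%R ->
  realizes m (fun g => lam um g * lam u g)%R -> theta m = lam u v1.
Hypothesis qM : {in G &, forall y g, q (y * g) = (q y + q g + lam (sb y) g)%R}.
Hypothesis sbE : {in G, forall y, (lam (sb y) v0 + lam (ub y) v1 = 0)%R}.
Hypothesis sbt : {in G, forall y, lam (sb y) t = 0%R}.
Hypothesis qPhi : {in 'Phi(G) & G, forall a g, q (a * g) = q g}.
Hypothesis qt : {in G, forall g, q (t * g) = q g}.

(** The derivation is to take values [t ^+ i * a] in an elementary abelian group, so [E] is cut down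
    to the centralizer of [t]. *)
Let Ct := 'C_E[t].
Let A := <[t]> <*> Ct.

Let Gt : t \in G. Proof. by case: lt => /setIP[]. Qed.

Let tW w : w \in W -> commute t w.
Proof. by case: lt => /setIP[_ /centP ct] _; apply: ct. Qed.

Let CtR y : y \in G -> [~ t, y] \in Ct.
Proof.
move=> Gy; case: lt => _ /(_ y Gy)[Wty [Ety _] _].
by rewrite inE Ety; apply/cent1P/esym/tW.
Qed.

Let CtE x : x \in Ct -> x \in E. Proof. by case/setIP. Qed.

(** [t ^ g^-1] differs from [t] by an element of the abelian group [E], so [x] commutes with it as
    well; then conjugate by [g]. *)
Let CtJ x g : x \in Ct -> g \in G -> x ^ g \in Ct.
Proof.
case/setIP=> Ex /cent1P cx Gg; rewrite inE EJ //=; apply/cent1P.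
have Ggv : g^-1 \in G by rewrite groupV.
have c1 : commute x (t ^ g^-1).
  rewrite conjg_mulR; apply: commuteM => //.
  by apply: commC; apply: EC => //; apply/CtE/CtR.
by rewrite -[t](conjgKV g) /commute -!conjMg c1.
Qed.

Let Ctz : z \in Ct.
Proof. by rewrite inE Ez; apply/cent1P; have /centerP[_ cz] := Zz; apply: cz. Qed.

Let defA : <[t]> \* Ct = A.
Proof.
by rewrite cprodEY // cent_cycle subsetIr.
Qed.

Let abA : p.-abelem A.
Proof.
rewrite (cprod_abelem _ defA) (abelemS (subsetIl _ _) abE) andbT.
by rewrite cycle_abelem ?pr_p ?orbT // order_dvdn tp.
Qed.

Let nAG : A <| G.
Proof.
have sAG : A \subset G.
  by rewrite join_subG cycle_subG Gt; apply/subsetP=> x /CtE /EG.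
apply/andP; split=> //; apply/subsetP=> g Gg; rewrite inE /A.
rewrite conjYg join_subG -cycleJ cycle_subG; apply/andP; split.
  rewrite conjg_mulR groupM ?(subsetP (joing_subl _ _) _ (cycle_id t)) //.
  by rewrite (subsetP (joing_subr _ _)) ?CtR.
apply/subsetP=> _ /imsetP[x Cx ->].
by rewrite (subsetP (joing_subr _ _)) ?CtJ.
Qed.

(** With [et] the coordinate function of [t], the difference of [psi] at [y] is [lam um y * et g],
    the coordinates of [t ^+ lam um y], plus a function covered by [represents_mul_lam]. Since [psi]
    is invariant under left translation by [W], [w] centralizes [W]. *)
Lemma derivation_with_values_in_low : exists2 w, w \in 'C_G(W) &
  {in G, forall y, exists2 a, a \in C & [~ y, w] = t ^+ lam um y * a}.
Proof.
have sCtA : Ct \subset A by apply: joing_subr.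
have sCtE : Ct \subset E by apply: subsetIl.
have chiCt : additive_on Ct chi by move=> x y Cx Cy; apply: chiD; apply: CtE.
have [chi' cA chi'E] := coordinate_extend nAG abA sCtA Ctz chiCt chiz.
have [_ _ _ chi'D _] := cA.
have CtA x : x \in Ct -> x \in A by apply: (subsetP sCtA).
have At : t \in A by rewrite (subsetP (joing_subl _ _)) ?cycle_id.
have AJ x g : x \in A -> g \in G -> x ^ g \in A.
  by move=> Ax Gg; rewrite memJ_norm // (subsetP (normal_norm nAG)).
have ubt y : y \in G -> lam (ub y) t = 0%R.
  by move=> Gy; case: lt => ct /(_ y Gy)[_ _ uv]; apply: lam_centW ct uv.
have umt : lam um t = 0%R by case: lt => ct _; apply: lam_centW ct umv.
pose et g := chi' (t ^ g).
have etM y g : y \in G -> g \in G -> et (y * g) = (et g + (lam (ub y) g + eps y))%R.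
  move=> Gy Gg; case: lt => _ /(_ y Gy)[_ [_ tyE] _].
  rewrite /et conjgM (conjg_mulR t y) conjMg (chi'D _ _ (AJ _ _ At Gg) (CtA _ (CtJ (CtR Gy) Gg))).
  by rewrite (chi'E _ (CtJ (CtR Gy) Gg)) tyE.
pose psi g := (lam um g * et g + q g)%R.
have psiM y g : y \in G -> g \in G -> (psi (y * g)%g - psi g =
    lam um y * et g + ((lam um y + lam um g) * (lam (ub y) g + eps y) + (lam (sb y) g + q y)))%R.
  by move=> Gy Gg; rewrite /psi lam_additive // etM // qM //; ring.
have psi_inv a g : a \in G -> g \in G -> lam um a = 0%R -> commute t a ->
    q (a * g) = q g -> psi (a * g) = psi g.
  move=> Ga Gg uma cta qa; rewrite /psi lam_additive // uma add0r qa.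
  by rewrite /et conjgM [t ^ a]/conjg cta mulKg.
have psi_t i g : g \in G -> psi (t ^+ i * g) = psi g.
  move=> Gg; elim: i => [|i IHi]; first by rewrite mul1g.
  rewrite expgS -mulgA psi_inv ?groupM ?groupX // ?qt ?groupM ?groupX //.
(* Here [um], [ub y] and [sb y] all vanish at [t], so the function is invariant under translation by
   [t] and [a] commutes with [t]. *)
have nP y : y \in G -> exists2 a, a \in Ct & {in G, forall g, chi (a ^ g) =
    ((lam um y + lam um g) * (lam (ub y) g + eps y) + (lam (sb y) g + q y))%R}.
  move=> Gy; have uv : lam (ub y) v0 = 0%R by case: lt => _ /(_ y Gy)[].
  have [a aP] := represents_mul_lam (lam um y) (eps y) (q y) umv uv v1E (sbE Gy).
  have [Ea aE] := aP; exists a => //; rewrite inE Ea; apply/cent1P.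
  apply/commgP/conjg_fixP; apply: (representsJ aP) => // g Gg /=.
  by rewrite !lam_additive // umt ubt // sbt // !add0r.
have [|w Gw wP] := derivation_of_function (psi := psi) cA.
  move=> y Gy; have [a Ca aE] := nP y Gy; have Ea := CtE Ca.
  exists (t ^+ lam um y * a); first exact: groupM (groupX _ At) (CtA _ Ca).
  move=> g Gg; split.
    rewrite conjMg (chi'D _ _ (AJ _ _ (groupX _ At) Gg) (CtA _ (CtJ Ca Gg))).
    rewrite (chi'E _ (CtJ Ca Gg)) aE // psiM //; congr (_ + _)%R.
    by rewrite conjXg (additive_onX _ chi'D) ?AJ // Fp_nat_val.
  have Ga := EG Ea; rewrite -mulgA psi_t ?groupM // psi_inv //.
  - by rewrite lam_Phi ?EPhi.
  - by case/setIP: Ca => _ /cent1P/esym.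
  by rewrite qPhi ?EPhi.
have wE y : y \in G -> exists2 a, a \in Ct & [~ y, w] = t ^+ lam um y * a.
  move=> Gy; have [a Ca aE] := nP y Gy; exists a => //.
  have [Aw wE] := wP y Gy; apply: (coordinate_inj cA) => //.
    exact: groupM (groupX _ At) (CtA _ Ca).
  move=> g Gg; rewrite wE // psiM //.
  rewrite conjMg (chi'D _ _ (AJ _ _ (groupX _ At) Gg) (CtA _ (CtJ Ca Gg))).
  rewrite (chi'E _ (CtJ Ca Gg)) aE //; congr (_ + _)%R.
  by rewrite conjXg (additive_onX _ chi'D) ?AJ // Fp_nat_val.
exists w; last by move=> y /wE[a /CtE/EC Ca ->]; exists a.
rewrite inE Gw; apply/centP=> y Wy; have Gy := subsetP sWG y Wy.
have Py := subsetP sWPhi y Wy.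
apply/esym/commgP; have [Aw wE'] := wP y Gy; apply/eqP.
apply: (coordinate_inj cA) => // g Gg; rewrite conj1g (additive_on1 chi'D) wE' //.
by rewrite psi_inv ?subrr ?lam_Phi ?qPhi //; apply: tW.
Qed.

End FinalDerivation.

(** Vanishing at [v0] is one linear condition on a space of dimension [n > 1]; a nonzero column of
    the cokernel matrix solves it. *)
Lemma lam_kernel_nontrivial : exists2 um, um != 0%R & lam um v0 = 0%R.
Proof.
pose K := cokermx (rho v0).
have K0 : K != 0%R.
  apply: contraTneq n_gt1 => K0; rewrite -leqNgt.
  have := mxrank_coker (rho v0); rewrite -/K K0 mxrank0 => /esym/eqP.
  by rewrite subn_eq0 => /leq_trans; apply; apply: rank_leq_row.
have [j Kj] : exists j, col j K != 0%R.
  apply/existsP; apply: contraNT K0; rewrite negb_exists => /forallP K0.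
  apply/eqP/matrixP=> i j; have := K0 j; rewrite negbK => /eqP/colP/(_ i).
  by rewrite !mxE.
by exists (col j K) => //; rewrite /lam colE mulmxA mulmx_coker mul0mx mxE.
Qed.

Lemma functional_mod_W x : x \in 'Phi(G) -> x \notin W ->
  exists phi : gT -> 'F_p,
    [/\ additive_on 'Phi(G) phi, {in W, forall w, phi w = 0%R} & phi x = 1%R].
Proof.
move=> Px W'x; apply: additive_on_separate => //.
  exact: normalS sWPhi sPhiG nWG.
have nWPhi : 'Phi(G) \subset 'N(W) by apply: subset_trans sPhiG (normal_norm nWG).
apply/abelemP=> //; split.
  apply: sub_der1_abelian; apply: subset_trans sPhiGW.
  exact: commgS.
move=> _ /morphimP[g Ng Pg ->]; rewrite -morphX //; apply: coset_id.
by apply: expW; apply: (subsetP sPhiG).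
Qed.

Lemma zz1 : zz 1%R != 1.
Proof. by rewrite -zz0 (inj_eq zz_inj) oner_eq0. Qed.

(** Write [[~ t, y * y']] as a product of conjugates of commutators and compare the coordinates at
    [v] with those at 1; the constants [eps] cancel. *)
Lemma low_additive t eps ub v : v \in G -> low t eps ub ->
  additive_on G (fun y => lam (ub y) v).
Proof.
move=> Gv [_ tP] y y' Gy Gy'.
have tE x g : x \in G -> g \in G -> chi ([~ t, x] ^ g) = (lam (ub x) g + eps x)%R.
  by move=> Gx Gg; have [_ [_ ->]] := tP x Gx.
have Et x : x \in G -> [~ t, x] \in E by case/tP=> _ [].
have tM g : g \in G -> (lam (ub (y * y')%g) g + eps (y * y')%g =
    lam (ub y') g + eps y' + (lam (ub y) (y' * g)%g + eps y))%R.
  move=> Gg; rewrite -!tE ?groupM // commgMJ conjMg -conjgM.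
  by rewrite (chiD (EJ (Et _ Gy') Gg) (EJ (Et _ Gy) (groupM Gy' Gg))).
have := tM 1 (group1 G); rewrite !lam1 mulg1 !add0r => e1.
apply: (addIr (eps (y * y')%g)); rewrite tM // e1 lam_additive //; ring.
Qed.

(** * The centralizer of W lies in W *)

Section Contradiction.
Variables (um : 'cV['F_p]_n) (v1 : gT).
Hypotheses (um0 : um != 0%R) (umv : lam um v0 = 0%R) (Gv1 : v1 \in G).
Hypothesis v1E : forall m u, lam u v0 = 0%R ->
  realizes m (fun g => lam um g * lam u g)%R -> theta m = lam u v1.

(** For [y] with [lam um y = 1], [[~ y, w]] is [t * a] with [a] in [C]; it lies in [W] because [w]
    lies in Phi(G). Now [b] centralizes both [W] and [a], hence [t]. *)
Lemma low_commutator_trivial t b eps ub : 'C_G(W) \subset 'Phi(G) ->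
    low t eps ub -> t ^+ p = 1 -> b \in 'C_G(W) ->
    (v0 \in 'Phi(G) -> {in G, forall y, lam (ub y) v1 = 0%R}) ->
  commute t b.
Proof.
move=> sCWPhi lt tp cb v0P; have [ct _] := lt.
have Pt := subsetP sCWPhi t ct; have Pb := subsetP sCWPhi b cb.
have Gt := subsetP sPhiG t Pt.
suff [w cw wE] : exists2 w, w \in 'C_G(W) &
    {in G, forall y, exists2 a, a \in C & [~ y, w] = t ^+ lam um y * a}.
  have [y Gy uy] := lam_onto 1%R um0; have [a Ca yw] := wE y Gy.
  have Wta : t * a \in W.
    have Pw := subsetP sCWPhi w cw; rewrite -[t]expg1 -[1%N](modn_small (prime_gt1 pr_p)).
    rewrite -(val_Fp_nat pr_p) -uy -yw -groupV invg_comm.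
    by rewrite (subsetP sPhiGW) ?mem_commg.
  have cba : commute b a by apply/esym/centC.
  have cbta : commute b (t * a) by case/setIP: cb => _ /centP; apply.
  apply/esym; rewrite -[t](mulgK a); apply: commuteM => //; exact: commuteV.
(* If [v0] is in Phi(G), every linear form vanishes at it and cannot compensate [theta], so
   [lam (ub y) v1] itself has to vanish. Otherwise a quadratic [q] compensates. *)
have [Pv0 | P'v0] := boolP (v0 \in 'Phi(G)).
  apply: (derivation_with_values_in_low (q := fun=> 0%R) (sb := fun=> 0%R) lt tp umv v1E) => //.
  - by move=> y g _ _; rewrite lam0 !addr0.
  - by move=> y Gy; rewrite lam0 add0r v0P.
  by move=> y _; rewrite lam0.
have [u0 u0v] : exists u0, lam u0 v0 = 1%R.
  have [/forallP v0z | /forallPn[u uv]] := boolP [forall u, lam u v0 == 0%R].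
    by case/negP: P'v0; apply: lam_separates => // u; apply/eqP.
  by exists ((lam u v0)^-1 *: u)%R; rewrite lamZ mulVf.
have [uj ujE] := hom_lam (low_additive Gv1 lt).
pose c := lam uj v0.
(* q has polar form s with s(y, v0) = - lam (ub y) v1. *)
pose q g := (2^-1 * c * (lam u0 g * lam u0 g) - lam uj g * lam u0 g)%R.
pose sb y := ((c * lam u0 y - lam uj y) *: u0 - lam u0 y *: uj)%R.
have halfc : (2^-1 * c + 2^-1 * c = c)%R by rewrite -mulrDl half_add mul1r.
apply: (derivation_with_values_in_low (q := q) (sb := sb) lt tp umv v1E).
- move=> y g Gy Gg; rewrite /q /sb !lam_additive // lamD lamN !lamZ.
  by move: (2^-1 * c)%R halfc => h <-; ring.
- move=> y Gy; rewrite /sb lamD lamN !lamZ u0v -/c -ujE //; ring.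
- by move=> y Gy; rewrite /sb lamD lamN !lamZ !(lam_Phi _ Pt) !mulr0 subr0.
- move=> a g Pa Gg; rewrite /q !(lam_additive _ (subsetP sPhiG a Pa) Gg).
  by rewrite !(lam_Phi _ Pa) !add0r.
by move=> g Gg; rewrite /q !lam_additive // !(lam_Phi _ Pt) !add0r.
Qed.

(* When t1 has theta t1 != 0, a second t2 not commuting with t1 is corrected by a
   power of t1. *)
Lemma centW_sub_of_sub_Phi : 'C_G(W) \subset 'Phi(G) -> 'C_G(W) \subset W.
Proof.
move=> sCWPhi; apply/subsetP=> x cx; apply: contraT => W'x.
have Px := subsetP sCWPhi x cx.
(* The condition at [v1] is imposed only when [v0] is in Phi(G), and then [[~ v0, v1]] falls in [W],
   as polarization requires; the value 1 makes the condition vacuous. *)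
pose v := if v0 \in 'Phi(G) then v1 else 1.
have Gv : v \in G by rewrite /v; case: ifP.
have vP : v0 \in 'Phi(G) -> v = v1 by rewrite /v => ->.
have phiv (phi : gT -> 'F_p) : additive_on 'Phi(G) phi ->
    {in W, forall w, phi w = 0%R} -> phi [~ v0, v] = 0%R.
  move=> phiD phiW; rewrite /v; case: ifP => Pv0; last by rewrite commg1 (additive_on1 phiD).
  by rewrite phiW // (subsetP sPhiGW) ?mem_commg.
have no_low t b eps ub : low t eps ub -> t ^+ p = 1 -> b \in 'C_G(W) ->
    {in G, forall y, lam (ub y) v = 0%R} -> [~ t, b] = 1.
  move=> lt tp cb ubv; apply/eqP/commgP.
  by apply: (low_commutator_trivial sCWPhi lt tp cb) => /vP <-.
have [phi [phiD phiW phix]] := functional_mod_W Px W'x.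
have [t1 [e1 [ub1 [l1 ub1v t1E]]]] := low_exists phiD phiW Gv (phiv _ phiD phiW).
have [ct1 _] := l1; have Gt1 : t1 \in G by case/setIP: ct1.
have t1x : [~ t1, x] != 1 by rewrite t1E // phix zz1.
have Gx := subsetP sPhiG x Px.
have [th1 | th1] := eqVneq (theta t1) 0%R.
  have [y Zy yp] := theta0 Gt1 (low_expp l1) th1.
  have l1y := lowM l1 (low_center Zy).
  have /eqP[] := t1x; rewrite -(no_low _ x _ _ l1y yp cx) => [|g Gg].
    have cyx : [~ y, x] = 1 by apply/eqP/commgP; have /centerP[_] := Zy; apply.
    by rewrite commMgJ cyx mulg1 t1E // zzJ //; case/setIP: Zy.
  by rewrite addr0 ub1v.
have W't1 : t1 \notin W.
  apply: contra t1x => Wt1; apply/commgP/esym.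
  by case/setIP: cx => _ /centP; apply.
have Pt1 := subsetP sCWPhi t1 ct1.
(* The form [phi'] is 1 at [t1], so that the resulting [t2] satisfies [[~ t2, t1] = z]; correcting
   [t2] by powers of [t1] does not change this commutator. *)
have [phi' [phiD' phiW' phit1]] := functional_mod_W Pt1 W't1.
have [t2 [e2 [ub2 [l2 ub2v t2E]]]] := low_exists phiD' phiW' Gv (phiv _ phiD' phiW').
have t2t1 : [~ t2, t1] = zz 1%R by rewrite t2E // phit1.
have Zt12 : [~ t1, t2] \in 'Z(G) by rewrite -invg_comm t2t1 groupV zz_center.
have [j [y [e3 [Zy yp l3]]]] := low_adjust l2 l1 Zt12 th1.
case/eqP: zz1; rewrite -t2t1 -(no_low _ t1 _ _ l3 yp ct1) => [|g Gg].
  have cy : [~ y, t1] = 1 by apply/eqP/commgP; have /centerP[_] := Zy; apply.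
  have cj : [~ t1 ^+ j, t1] = 1 by apply/eqP/commgP/commute_sym/commuteX.
  by rewrite !commMgJ cy cj !mulg1 t2t1 !zzJ // ?groupX //; case/setIP: (ZC Zy).
by rewrite lamD lamZ ub2v // ub1v // mulr0 addr0.
Qed.

(* An element of C_G(W) outside Phi(G) forces v0 to be outside Phi(G), so some k
   realizing a homomorphism has theta k != 0 and can be used to adjust t; since t
   is now outside Phi(G), d takes values outside Phi(G). *)
Lemma centW_sub_Phi : 'C_G(W) \subset 'Phi(G).
Proof.
apply: contraT => /subsetPn[y0 cy0 P'y0].
have Gy0 : y0 \in G by case/setIP: cy0.
have [u uy0] : exists u, lam u y0 != 0%R.
  apply/existsP; apply: contraNT P'y0; rewrite negb_exists => /forallP y00.
  by apply: lam_separates => // u; have := y00 u; rewrite negbK => /eqP.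
have uv0 : lam u v0 != 0%R by apply: contraNneq uy0 => /(lam_centW cy0) ->.
have [k [kP kE]] := realizes_hom u; have [Ck _] := kP.
have Pk := subsetP sCPhi k Ck; have Gk := subsetP sCG k Ck.
have W'k : k \notin W.
  apply: contra uy0 => Wk; rewrite -(inj_eq zz_inj) -kE // zz0.
  by apply/commgP/esym; case/setIP: cy0 => _ /centP; apply.
have [phi [phiD phiW phik]] := functional_mod_W Pk W'k.
(* [[~ k, t]] is both the inverse of [z] and [z] to the power [lam u t], so [t] lies outside
   Phi(G). *)
have low_k t eps ub : low t eps ub -> [~ t, k] = zz (phi k) -> lam u t != 0%R.
  case=> /setIP[Gt _] _ tk; apply: contra_neq zz1 => ut.
  by rewrite -phik -tk -invg_comm kE // ut zz0 invg1.
(* Let [u'] be the form [phi [~ _, v1]]. It vanishes at [h] since [[~ h, v1]] lies in [W], and so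
   does the combination of [u'] and [u] vanishing at [v0]. As [lam u h] is nonzero, the coefficient
   of [u] is zero, that is, [u'] vanishes at [v0]. *)
have phiv : phi [~ v0, v1] = 0%R.
  have phi1 : phi [~ v0, 1] = 0%R by rewrite commg1 (additive_on1 phiD).
  have [h [e [ub [lh _ hE]]]] := low_exists phiD phiW (group1 G) phi1.
  have uh := low_k h e ub lh (hE k Pk).
  have [ch hP] := lh; have Gh : h \in G by case/setIP: ch.
  have [u' u'E] := hom_lam (phi_comml phiD phiW Gv1).
  have u'h : lam u' h = 0%R by rewrite -u'E // phiW //; case: (hP v1 Gv1).
  pose a := (lam u' v0 / lam u v0)%R.
  have au : lam (u' - a *: u)%R v0 = 0%R by rewrite lamD lamN lamZ divfK // subrr.
  have /eqP := lam_centW ch au; rewrite lamD lamN lamZ u'h sub0r oppr_eq0 mulf_eq0.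
  rewrite (negPf uh) orbF mulf_eq0 invr_eq0 (negPf uv0) orbF => /eqP u'v.
  by rewrite -[RHS]u'v -u'E.
have [t1 [e1 [ub1 [l1 ub1v t1E]]]] := low_exists phiD phiW Gv1 phiv.
have ut1 := low_k t1 e1 ub1 l1 (t1E k Pk).
(* The commutators of [k] are the powers [z ^+ lam u y], with zero linear part, so adjusting by [k]
   does not spoil vanishing at [v1]. *)
have lk : low k (lam u) (fun=> 0%R).
  split=> [|y Gy].
    by rewrite inE Gk (subsetP (centS sWPhi)) //; case/setIP: Ck.
  rewrite kE // lam0; split; rewrite ?groupX //.
  by apply: represents_ext (represents_zz _) _ => g _; rewrite lam0 add0r.
have Zkt : [~ k, t1] \in 'Z(G) by rewrite -invg_comm t1E // groupV zz_center.
have thk : theta k != 0%R by rewrite (v0E kP).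
have [j [y [e [Zy tp lt]]]] := low_adjust l1 lk Zkt thk.
have P't : t1 * k ^+ j * y \notin 'Phi(G).
  apply: contra ut1 => Pt; rewrite -(mulgK (k ^+ j * y) t1) mulgA lam_Phi //.
  by rewrite groupM // groupV groupM ?groupX // (subsetP sCPhi) ?ZC.
set t := t1 * k ^+ j * y in lt tp P't.
have [|||||w cw wE] := derivation_with_values_in_low (q := fun=> 0%R) (sb := fun=> 0%R) lt tp umv v1E => //.
- by move=> x g _ _; rewrite lam0 !addr0.
- by move=> x Gx; rewrite lam0 add0r lamD lamZ lam0 mulr0 addr0 ub1v.
- by move=> x _; rewrite lam0.
have [x Gx ux] := lam_onto 1%R um0; have [a Ca xw] := wE x Gx.
case/negP: P't; rewrite -(mulgK a t) groupM ?groupV ?(subsetP sCPhi a) //.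
rewrite -[t]expg1 -[1%N](modn_small (prime_gt1 pr_p)) -(val_Fp_nat pr_p) -ux -xw.
by apply: der_Phi => //; case/setIP: cw.
Qed.

End Contradiction.
End Exponent.
End Coordinate.

Lemma centW_sub : 'C_G(W) \subset W.
Proof.
have [chi cE] := coordinateE_exists.
have [v0 Gv0 v0E] := theta_hom cE.
have [um um0 umv] := lam_kernel_nontrivial v0.
have [v1 Gv1 v1E] := theta_mul cE v0E umv.
apply: (centW_sub_of_sub_Phi cE Gv0 v0E um0 umv Gv1 v1E).
exact: (centW_sub_Phi cE Gv0 v0E um0 umv Gv1 v1E).
Qed.

End Core.

(** * From the hypotheses of the theorem to those of the core argument *)

Lemma inner_autP (gT : finGroupType) (G : {group gT}) (a : {perm gT}) :
  reflect (inner_aut G a) [exists h in G, [forall g in G, a g == g ^ h]].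
Proof.
apply: (iffP exists_inP) => [[h Gh /forall_inP ah] | [h Gh ah]]; exists h => //.
  by move=> g Gg; apply/eqP/ah.
by apply/forall_inP=> g Gg; apply/eqP/ah.
Qed.

(** Since [d (d x) = 1], the m-th iterate of x |-> x d(x) is x |-> x d(x)^m, so the p-th is trivial.
    The map is extended by the identity outside [G]. *)
Lemma derivation_inner_or (gT : finGroupType) (p : nat) (G : {group gT}) (d : gT -> gT) :
    prime p -> {in G &, forall x y, d (x * y) = d x ^ y * d y} ->
    {in G, forall x, [/\ d x \in G, d x ^+ p = 1 & d (d x) = 1]} ->
  (exists2 h, h \in G & {in G, forall g, d g = [~ g, h]}) \/
  (exists a : {perm gT}, [/\ a \in Aut G, #[a] = p & ~ inner_aut G a]).
Proof.
move=> pr_p dM dP; pose f x := if x \in G then x * d x else x.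
have dd x : x \in G -> d (x * d x) = d x.
  by move=> Gx; have [Gd _ ddx] := dP x Gx; rewrite dM // ddx mulg1 conjgE mulKg.
have fG x : x \in G -> f x \in G.
  by move=> Gx; rewrite /f Gx groupM //; case: (dP x Gx).
have f_inj : injective f.
  move=> x y; have [Gx | G'x] := boolP (x \in G); have [Gy | G'y] := boolP (y \in G).
  - rewrite /f Gx Gy => e; have dxy : d x = d y by rewrite -(dd x Gx) e dd.
    by move: e; rewrite dxy => /mulIg.
  - by move=> e; have := fG x Gx; rewrite e /f (negPf G'y) => Gy; rewrite Gy in G'y.
  - by move=> e; have := fG y Gy; rewrite -e /f (negPf G'x) => Gx; rewrite Gx in G'x.
  by rewrite /f (negPf G'x) (negPf G'y).
pose a := perm f_inj.
have aE x : x \in G -> a x = x * d x by rewrite permE /f => ->.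
have Aa : a \in Aut G.
  rewrite inE; apply/andP; split.
    by apply/subsetP=> x; apply: contraR => G'x; rewrite permE /f (negPf G'x).
  apply/morphicP=> x y Gx Gy; rewrite !aE ?groupM // dM //.
  by rewrite conjgE !mulgA mulgK.
have aX m x : x \in G -> (a ^+ m) x = x * d x ^+ m.
  move=> Gx; elim: m => [|m IHm]; first by rewrite expg0 perm1 mulg1.
  have [Gd _ ddx] := dP x Gx; rewrite expgSr permM IHm aE ?groupM ?groupX //.
  have dX k : d (d x ^+ k) = 1.
    elim: k => [|k IHk]; last by rewrite expgS dM ?groupX // ddx IHk conj1g mulg1.
    have := dM 1 1 (group1 G) (group1 G).
    by rewrite conjg1 mulg1 => /eqP; rewrite eq_sym -[X in _ == X]mulg1 => /eqP/mulgI.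
  rewrite dM ?groupX // dX mulg1 -mulgA; congr (_ * _).
  by rewrite conjgE mulKVg expgS.
have [inn | ninn] := boolP [exists h in G, [forall g in G, a g == g ^ h]].
  have [h Gh ah] := inner_autP _ _ inn; left; exists h => // g Gg.
  by rewrite commgEl -ah // aE // mulKg.
right; exists a; split=> //; last by move/inner_autP; apply/negP.
apply: nt_prime_order => //.
  apply/permP=> x; rewrite perm1; have [Gx | G'x] := boolP (x \in G).
    by rewrite aX //; have [_ -> _] := dP x Gx; rewrite mulg1.
  apply: out_Aut G'x; exact: groupX.
apply: contra ninn => /eqP a1; apply/exists_inP; exists 1 => //.
by apply/forall_inP=> g Gg; rewrite a1 perm1 conjg1.
Qed.

Lemma mem_Ohm1_abelian (gT : finGroupType) (p : nat) (A : {group gT}) x :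
  p.-group A -> abelian A -> (x \in 'Ohm_1(A)) = (x \in A) && (x ^+ p == 1).
Proof.
move=> pA cA; rewrite (OhmEabelian pA) ?inE ?expn1 //.
exact: abelianS (Ohm_sub 1 A) cA.
Qed.

Lemma commg_Phi_sub (gT : finGroupType) (p : nat) (G W : {group gT}) :
    p.-group G -> W :=: 'L_3(G) <*> 'Mho^1(G) -> W <| G ->
  [/\ W \subset 'Phi(G), [~: 'Phi(G), G] \subset W & {in G, forall g, g ^+ p \in W}].
Proof.
move=> pG defW /andP[sWG nWG].
have sL3W : 'L_3(G) \subset W by rewrite defW joing_subl.
have sMW : 'Mho^1(G) \subset W by rewrite defW joing_subr.
split=> [||g Gg].
- rewrite defW (Phi_joing pG) join_subG joing_subr andbT.
  by apply: subset_trans (joing_subl _ _); rewrite lcnSn commSg // lcn_sub.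
- have nPhi : 'Phi(G) \subset 'N(W) by apply: subset_trans (Phi_sub G) nWG.
  rewrite -quotient_cents2 // (Phi_joing pG).
  have nG' : G^`(1) \subset 'N(W) by apply: subset_trans (der_sub 1 G) nWG.
  have nM : 'Mho^1(G) \subset 'N(W) by apply: subset_trans (Mho_sub 1 G) nWG.
  rewrite quotientY // join_subG !quotient_cents2 //; apply/andP; split.
    by move: sL3W; rewrite lcnSn lcn2.
  apply: subset_trans sMW; rewrite commg_subl; exact: gFnorm.
apply: (subsetP sMW); rewrite -[p]expn1; apply: Mho_p_elt => //.
exact: mem_p_elt pG Gg.
Qed.

Theorem theorem4p5 (gT : finGroupType) (p : nat) (G : {group gT})
    (T : nat) (P : nat -> {group gT}) (i : nat) :
  prime p -> odd p -> p.-group G -> ~~ abelian G -> cyclic 'Z(G) ->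
  'Ohm_1('Z(G)) \subset 'L_3(G) <*> 'Mho^1(G) ->
  #|'Phi(G) : 'L_3(G) <*> 'Mho^1(G)| = (p ^ T)%N -> (0 < T)%N ->
  P 0%N = 'Phi(G) :> {set gT} ->
  P T = 'L_3(G) <*> 'Mho^1(G) :> {set gT} ->
  (forall k, (k <= T)%N -> P k <| G) ->
  (forall k, (k < T)%N -> P k.+1 \subset P k) ->
  (forall k, (k < T)%N -> #|P k : P k.+1| = p) ->
  (i < T)%N ->
  'C_G(P i) \subset P i ->
  (forall d : gT -> gT, is_derivation G (P i) 'Ohm_1('Z(P i)) d ->
     induced_aut_inner G d) ->
  ~~ ('C_G(P i.+1) \subset P i.+1) ->
  exists a : {perm gT}, [/\ a \in Aut G, #[a] = p & ~ inner_aut G a].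
Proof.
move=> pr_p odd_p pG nabG cycZ sOW _ _ P0 PT nPG sPS _ ltiT sCP der_inn nsCP.
have [/exists_inP[a Aa /andP[/eqP oa /inner_autP na]] | no_a] := boolP
    [exists a in Aut G, (#[a] == p) && ~~ [exists h in G, [forall g in G, a g == g ^ h]]].
  by exists a.
have derivation_inner d : {in G &, forall x y, d (x * y) = d x ^ y * d y} ->
    {in G, forall x, [/\ d x \in G, d x ^+ p = 1 & d (d x) = 1]} ->
    exists2 h, h \in G & {in G, forall g, d g = [~ g, h]}.
  move=> dM dP; have [// | [a [Aa oa na]]] := derivation_inner_or pr_p dM dP.
  by case/exists_inP: no_a; exists a => //; rewrite oa eqxx; apply/inner_autP.
have chain m k : (m + k <= T)%N -> P (m + k)%N \subset P k.
  elim: m => // m IHm lemT; apply: subset_trans (sPS _ lemT) (IHm (ltnW lemT)).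
have chain2 j k : (j <= k <= T)%N -> P k \subset P j.
  by case/andP=> lejk lekT; rewrite -(subnK lejk) chain // subnK.
pose W := P T; have nWG : W <| G by apply: nPG.
have [sWPhi sPhiGW expW] := commg_Phi_sub pG PT nWG.
have sWP : W \subset P i by rewrite chain2 // (ltnW ltiT) leqnn.
have sPPhi : P i \subset 'Phi(G) by rewrite -P0 chain2 // (ltnW ltiT).
have sPG : P i \subset G := subset_trans sPPhi (Phi_sub G).
have sCPhi : 'C_G('Phi(G)) \subset 'Phi(G).
  apply: subset_trans (subset_trans sCP sPPhi); exact: setIS (centS sPPhi).
have pZ : p.-group 'Z(G) := pgroupS (center_sub G) pG.
have ntG : G :!=: 1 by apply: contraNneq nabG => ->; apply: abelian1.
have ntZ : 'Z(G) != 1 by rewrite center_nil_eq1 ?(pgroup_nil pG).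
have oO := Ohm1_cyclic_pgroup_prime cycZ pZ ntZ.
have /cyclicP[z defO] : cyclic 'Ohm_1('Z(G)) := cyclicS (Ohm_sub 1 _) cycZ.
have /cyclicP[z0 defZ] := cycZ.
have oz : #[z] = p by rewrite -oO defO.
have Oz : z \in 'Ohm_1('Z(G)) by rewrite defO cycle_id.
have Wz : z \in W by rewrite /W PT (subsetP sOW).
have Zz : z \in 'Z(G) := subsetP (Ohm_sub 1 _) z Oz.
have zp : z ^+ p = 1 by rewrite -oz expg_order.
have Z1z : {in 'Z(G), forall x, x ^+ p = 1 -> x \in <[z]>}.
  move=> x Zx xp; rewrite -defO (mem_Ohm1_abelian _ pZ) ?center_abelian //.
  by rewrite Zx xp eqxx.
have OPz : z \in 'Ohm_1('Z(P i)).
  have pZP : p.-group 'Z(P i) := pgroupS (subset_trans (center_sub _) sPG) pG.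
  rewrite (mem_Ohm1_abelian _ pZP) ?center_abelian // zp eqxx andbT.
  by rewrite inE (subsetP sWP) // (subsetP (centS sPG)) //; case/setIP: Zz.
have hom_inner (f : gT -> 'F_p) : additive_on G f ->
    exists2 k, k \in 'C_G('Phi(G)) & {in G, forall g, [~ k, g] = z ^+ f g}.
  (* A homomorphism to F_p kills Phi(G), hence [P i], and [z] lies in Omega_1(Z(P_i)), so the
     assumption on derivations applies. The inverse makes [[~ h, g]], rather than [[~ g, h]], equal
     to [z ^+ f g]. *)
  move=> fD; pose d g := (z ^+ f g)^-1.
  have zfM x y : x \in G -> y \in G -> z ^+ f (x * y) = z ^+ f x * z ^+ f y.
    by move=> Gx Gy; rewrite fD //; apply: zzD.
  have zG x m : x \in G -> (z ^+ m) ^ x = z ^+ m.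
    move=> Gx; apply/conjg_fixP/commgP; have /centerP[_] : z ^+ m \in 'Z(G).
      exact: groupX.
    exact.
  have fPhi x : x \in 'Phi(G) -> f x = 0%R := additive_on_Phi pr_p pG fD.
  have [|h Gh hE] := der_inn d.
    split=> [x y Gx Gy | x Gx | x Px].
    - by rewrite /d zfM // invMg conjVg zG // -!expgVn; apply: commuteX2.
    - by rewrite groupV groupX.
    by rewrite /d fPhi ?invg1 // (subsetP sPPhi).
  have hC g : g \in G -> [~ h, g] = z ^+ f g.
    move=> Gg; rewrite -invg_comm commgEl -hE // mulKg; exact: invgK.
  exists h => //; rewrite inE Gh; apply/centP=> y Py; apply/commgP.
  by rewrite hC ?fPhi // (subsetP (Phi_sub G)).
have ncG : ~~ cyclic G by apply: contra nabG; apply: cyclic_abelian.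
have [n [rho [n_gt1 rhoM rho_onto rho_inj]]] := Frattini_coordinates pG ncG.
have sCW : 'C_G(W) \subset W.
  exact: (centW_sub pr_p odd_p pG oz Wz Zz defZ Z1z nWG sWPhi sPhiGW expW sCPhi
            hom_inner derivation_inner n_gt1 rhoM rho_onto rho_inj).
have sWP1 : W \subset P i.+1 by rewrite chain2 // ltiT leqnn.
(* C_G(P_(i+1)) <= C_G(W) <= W <= P_(i+1), against the assumption. *)
case/negP: nsCP; apply: subset_trans (subset_trans sCW sWP1).
exact: setIS (centS sWP1).
Qed.
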